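(* Let $q$ be a prime power and let $\ell,t$ be positive integers; put $\tau=\ell+t-1$. Let $\mathcal{E}$ be the type I group (prescribing $\ell$ leading and $t$ ending coefficients, with nonzero constant term), written as an internal direct product of cyclic groups with generators $\xi_1,\dots,\xi_f$ of orders $r_1,\dots,r_f$, and let $\omega_{r_i}=\exp(2\pi\sqrt{-1}/r_i)$ for $1\le i\le f$. For $\vec j\in\mathcal{J}$ let $P_{\vec j}(z)=1+\sum_{k=1}^{\tau}c_{k,\vec j}z^k$, and let $\mathcal{S}_{\vec j}$ be the multiset of all complex roots of $P_{\vec j}(z)$. Then for every $d\ge1$ the number $I_d(\vec t)$ of monic irreducible polynomials of degree $d$ over $\mathbb{F}_q$ whose first $\ell$ coefficients and last $t$ coefficients are those prescribed by the class $\varepsilon=\xi_1^{t_1}\cdots\xi_f^{t_f}$ is $$I_d(\vec t)=\frac1d\sum_{k\mid d}\mu(k)\sum_{\vec s\in\mathcal{R}}N_{d/k}(\vec s)\,\left[\!\left[k\vec s\equiv\vec t\pmod{\vec r}\right]\!\right],$$ where, for $n\ge1$ and $\vec s\in\mathcal{R}$, $$N_n(\vec s)=\frac{1}{q-1}q^{-\tau}(q^n-1)+\frac1{q-1}q^{-\tau}\sum_{\vec j\in\mathcal{J}}\prod_{i=1}^f\omega_{r_i}^{-j_is_i}\;n[z^n]\ln P_{\vec j}(z)$$ $$\phantom{N_n(\vec s)}=\frac{1}{q-1}q^{-\tau}(q^n-1)-\frac1{q-1}q^{-\tau}\sum_{\vec j\in\mathcal{J}}\prod_{i=1}^f\omega_{r_i}^{-j_is_i}\sum_{\rho\in\mathcal{S}_{\vec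 j}}\rho^{-n}.$$
   Context: $\mathcal{M}$ is the set of monic polynomials over $\mathbb{F}_q$ (including the constant $1$), $\mathcal{M}_d$ those of degree $d$; the reciprocal of $f$ is $\tilde f(x)=x^{\deg f}f(1/x)$. Type I equivalence: monic $f,g$ with $f(0)g(0)\neq0$ are equivalent if $\tilde f\equiv\tilde g\pmod{x^{\ell+1}}$ and $f\equiv g\pmod{x^t}$ (i.e. they have the same $\ell$ leading coefficients after the leading 1 and the same $t$ ending coefficients, missing coefficients being read as $0$). $\mathcal{E}$ is the set of equivalence classes $\langle f\rangle$ of monic $f$ with $f(0)\ne0$; it is a finite abelian group of order $(q-1)q^{\ell+t-1}$ under $\langle f\rangle\langle g\rangle=\langle fg\rangle$. Convention: $\langle f\rangle:=0$ (zero of $\mathbb{C}\mathcal{E}$) if $f(0)=0$. $I_d(\vec t)=I_d(\varepsilon)=\#\{f\in\mathcal{M}_d: f\text{ irreducible},\ \langle f\rangle=\varepsilon\}$ for $\varepsilon=\prod_i\xi_i^{t_i}$. $N_n(\vec s)=N_n(\varepsilon):=n[z^n\varepsilon]\ln F(z)$ for $\varepsilon=\prod_i\xi_i^{s_i}$, where $F(z)=\sum_{f\in\mathcal{M}}\langle f\rangle z^{\deg f}\in\mathbb{C}\mathcal{E}[[z]]$ and $[z^n\varepsilon]$ extracts the coefficient of $z^n\varepsilon$. $\mathcal{E}$ is the internal direct product of the cyclic groups $C_{r_i}=\langle\xi_i\rangle$ of order $r_i$. With $[n]=\{1,\dots,n\}$: $\mathcal{R}=[r_1]\times\cdots\times[r_f]$,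 $\vec r=(r_1,\dots,r_f)$, $\mathcal{J}=\mathcal{R}\setminus\{\vec r\}$. The condition $k\vec s\equiv\vec t\pmod{\vec r}$ means $ks_i\equiv t_i\pmod{r_i}$ for all $i$; $[\![\cdot]\!]$ is the Iverson bracket (1 if true, 0 if false); $\mu$ is the Möbius function. For $1\le d\le\tau$, $\mathcal{E}_d=\{\langle f\rangle:f\in\mathcal{M}_d,\ f(0)\ne0\}$, and for $\vec j\in\mathcal{R}$, $c_{d,\vec j}=\sum_{\varepsilon\in\mathcal{E}_d}\prod_{i=1}^f\omega_{r_i}^{v_ij_i}$ where $\varepsilon=\prod_{i=1}^f\xi_i^{v_i}$. *)

(* Defs.v *)
From HB Require Import structures.
From mathcomp Require Import all_boot all_order all_algebra all_fingroup.
From mathcomp Require Import boolp reals trigo complex.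

Set Implicit Arguments.
Unset Strict Implicit.
Unset Printing Implicit Defensive.

Import GRing.Theory.
Local Open Scope ring_scope.
Local Open Scope quotient_scope.

(* [x^(deg f) f(1/x)]: the coefficients of [f] in reverse order. *)
Definition recip (F : fieldType) (f : {poly F}) : {poly F} :=
  \poly_(i < size f) f`_((size f).-1 - i).

Section RecipTheory.
Variable F : fieldType.
Implicit Types f g : {poly F}.

Let revn n f : {poly F} := \sum_(i < n.+1) f`_i *: 'X^(n - i).

Let revn_sum n (I : Type) (s : seq I) (E : I -> {poly F}) :
  revn n (\sum_(i <- s) E i) = \sum_(i <- s) revn n (E i).
Proof.
rewrite /revn exchange_big /=; apply: eq_bigr => i _.
by rewrite coef_sum scaler_suml.
Qed.

Let revnZX n c k : (k <= n)%N -> revn n (c *: 'X^k) = c *: 'X^(n - k).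
Proof.
move=> lekn; have ltkn : (k < n.+1)%N by [].
rewrite /revn (bigD1 (Ordinal ltkn)) //= coefZ coefXn eqxx mulr1 big1 ?addr0 //.
move=> i; rewrite -val_eqE /= => /negPf ik.
by rewrite coefZ coefXn ik mulr0 scale0r.
Qed.

Let recipE n f : size f = n.+1 -> recip f = revn n f.
Proof.
move=> sf; rewrite /recip sf poly_def (reindex_inj rev_ord_inj) /=.
apply: eq_bigr => i _; rewrite !subSS subKn //.
exact: ltn_ord i.
Qed.

Lemma recipM f g : f != 0 -> g != 0 -> recip (f * g) = recip f * recip g.
Proof.
move=> f0 g0; have [n sf] : exists n, size f = n.+1.
  by exists (size f).-1; rewrite prednK // size_poly_gt0.
have [m sg] : exists m, size g = m.+1.
  by exists (size g).-1; rewrite prednK // size_poly_gt0.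
have sfg : size (f * g) = (n + m).+1 by rewrite size_mul // sf sg addSn addnS.
rewrite (recipE sfg) (recipE sf) (recipE sg).
have fE : f = \sum_(i < n.+1) f`_i *: 'X^i by rewrite -poly_def -sf coefK.
have gE : g = \sum_(i < m.+1) g`_i *: 'X^i by rewrite -poly_def -sg coefK.
rewrite {1}fE {1}gE big_distrlr revn_sum /revn big_distrlr /=.
apply: eq_bigr => i _; rewrite -/(revn _ _) revn_sum; apply: eq_bigr => j _.
have lin : (i <= n)%N := ltn_ord i.
have ljm : (j <= m)%N := ltn_ord j.
rewrite -!scalerAl -!scalerAr !scalerA -!exprD revnZX ?leq_add //.
by congr (_ *: 'X^_); rewrite subnDA -addnBAC // addnBA.
Qed.

Lemma recip_at0 f : (recip f)`_0 = lead_coef f.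
Proof.
rewrite coef_poly subn0 lead_coefE; case: ltnP => //.
by rewrite leqn0 size_poly_eq0 => /eqP->; rewrite coef0.
Qed.

End RecipTheory.

Section TypeIGroup.
Variables (F : finFieldType) (ell t : nat).

Definition typeI_dom (f : {poly F}) := (f \is monic) && (f.[0] != 0).

Record typeI_poly := TypeIPoly {
  typeI_val :> {poly F};
  typeI_valP : typeI_dom typeI_val
}.
HB.instance Definition _ := [isSub for typeI_val].
HB.instance Definition _ := [Choice of typeI_poly by <:].

Definition typeI_eqv (f g : typeI_poly) : bool :=
  ('X^(ell.+1) %| recip f - recip g) && ('X^t %| (f : {poly F}) - (g : {poly F})).

Fact typeI_eqv_refl : reflexive typeI_eqv.
Proof. by move=> f; rewrite /typeI_eqv !subrr !dvdp0. Qed.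

Fact typeI_eqv_sym : symmetric typeI_eqv.
Proof.
move=> f g; rewrite /typeI_eqv -[recip f - _]opprB -[(f : {poly F}) - _]opprB.
by rewrite !dvdpNr.
Qed.

Fact typeI_eqv_trans : transitive typeI_eqv.
Proof.
move=> g f h /andP[a1 a2] /andP[b1 b2]; rewrite /typeI_eqv.
have E (x y z : {poly F}) : x - z = (x - y) + (y - z) by rewrite addrA subrK.
apply/andP; split.
  by rewrite (E _ (recip g)) dvdp_add.
by rewrite (E _ (g : {poly F})) dvdp_add.
Qed.

Canonical typeI_eqv_equiv :=
  EquivRel typeI_eqv typeI_eqv_refl typeI_eqv_sym typeI_eqv_trans.

Definition typeI : predArgType := {eq_quot typeI_eqv}.
HB.instance Definition _ := EqQuotient.on typeI.
HB.instance Definition _ := Choice.on typeI.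

Fact typeI_one_proof : typeI_dom 1.
Proof. by rewrite /typeI_dom monic1 hornerC oner_eq0. Qed.
Definition typeI_poly1 := TypeIPoly typeI_one_proof.

Fact typeI_mul_proof (f g : typeI_poly) : typeI_dom ((f : {poly F}) * (g : {poly F})).
Proof.
case: f g => [f /andP[mf f0]] [g /andP[mg g0]] /=.
by rewrite /typeI_dom monicMl // mg hornerM mulf_neq0.
Qed.
Definition typeI_polyM f g := TypeIPoly (typeI_mul_proof f g).

Let tI_neq0 (f : typeI_poly) : (f : {poly F}) != 0.
Proof. by case: f => [f /andP[mf _]] /=; exact: monic_neq0. Qed.

Fact typeI_eqvM f f' g g' : typeI_eqv f f' -> typeI_eqv g g' ->
  typeI_eqv (typeI_polyM f g) (typeI_polyM f' g').
Proof.
move=> /andP[a1 a2] /andP[b1 b2]; rewrite /typeI_eqv /= !recipM //.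
have E (x x' y y' : {poly F}) :
    x * y - x' * y' = (x - x') * y + x' * (y - y').
  by rewrite mulrBl mulrBr addrA subrK.
by apply/andP; split; rewrite E dvdp_add //; (exact: dvdp_mulr || exact: dvdp_mull).
Qed.

Let coprimeXn n (p : {poly F}) : p`_0 != 0 -> coprimep ('X^n) p.
Proof.
move=> p0; apply: coprimep_expl; rewrite coprimep_sym.
by rewrite -['X]subr0 -[0]/(0%:P) coprimep_XsubC /root horner_coef0.
Qed.

Fact typeI_eqv_cancel f g h :
  typeI_eqv (typeI_polyM f g) (typeI_polyM f h) -> typeI_eqv g h.
Proof.
rewrite /typeI_eqv /= !recipM // -!mulrBr.
have f0 : typeI_val f != 0 by [].
rewrite !Gauss_dvdpr //.
  by case/andP: (typeI_valP f) => _ f0'; apply: coprimeXn; rewrite -horner_coef0.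
apply: coprimeXn; rewrite recip_at0.
by rewrite lead_coef_eq0.
Qed.

Local Notation rep := (@generic_quotient.repr typeI_poly typeI).

Definition typeI_mul (x y : typeI) : typeI :=
  \pi_typeI (typeI_polyM (rep x) (rep y)).
Definition typeI_one : typeI := \pi_typeI typeI_poly1.

Lemma typeI_piE (f g : typeI_poly) :
  (\pi_typeI f == \pi_typeI g) = typeI_eqv f g.
Proof. exact: (@pi_eq_quot _ typeI_eqv typeI). Qed.

Lemma typeI_piM f g :
  typeI_mul (\pi_typeI f) (\pi_typeI g) = \pi_typeI (typeI_polyM f g).
Proof.
by apply/eqP; rewrite typeI_piE; apply: typeI_eqvM; rewrite -typeI_piE reprK.
Qed.

Let typeI_ind (P : typeI -> Prop) : (forall f, P (\pi_typeI f)) -> forall x, P x.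
Proof. by move=> H x; rewrite -[x]reprK. Qed.

Fact typeI_mulC : commutative typeI_mul.
Proof.
elim/typeI_ind=> f; elim/typeI_ind=> g; rewrite !typeI_piM.
by congr \pi_typeI; apply: val_inj => /=; rewrite mulrC.
Qed.

Fact typeI_mulA : associative typeI_mul.
Proof.
elim/typeI_ind=> f; elim/typeI_ind=> g; elim/typeI_ind=> h; rewrite !typeI_piM.
by congr \pi_typeI; apply: val_inj => /=; rewrite mulrA.
Qed.

Fact typeI_mul1 : left_id typeI_one typeI_mul.
Proof.
elim/typeI_ind=> f; rewrite typeI_piM.
by congr \pi_typeI; apply: val_inj => /=; rewrite mul1r.
Qed.

Fact typeI_mulI : right_injective typeI_mul.
Proof.
elim/typeI_ind=> f; elim/typeI_ind=> g; elim/typeI_ind=> h; rewrite !typeI_piM.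
move/eqP; rewrite typeI_piE => /typeI_eqv_cancel.
by rewrite -typeI_piE => /eqP.
Qed.

Definition typeI_code (x : typeI) : {ffun 'I_ell.+1 -> F} * {ffun 'I_t -> F} :=
  ([ffun i : 'I_ell.+1 => (recip (rep x))`_i],
   [ffun i : 'I_t => (rep x : {poly F})`_i]).

Let dvdXn n (p : {poly F}) : (forall i, (i < n)%N -> p`_i = 0) -> 'X^n %| p.
Proof.
move=> p0; apply/modp_eq0P; rewrite -Pdiv.IdomainMonic.take_poly_modp; apply/polyP => i.
by rewrite coef_take_poly coef0; case: ifP => // /p0.
Qed.

Fact typeI_code_inj : injective typeI_code.
Proof.
move=> x y [/ffunP e1 /ffunP e2]; apply/eqP.
rewrite -[x]reprK -[y]reprK typeI_piE /typeI_eqv; apply/andP; split.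
  apply: dvdXn => i lti; have := e1 (Ordinal lti).
  by rewrite !ffunE coefB => -> /=; rewrite subrr.
apply: dvdXn => i lti; have := e2 (Ordinal lti).
by rewrite !ffunE coefB => -> /=; rewrite subrr.
Qed.

Definition typeI_decode (c : {ffun 'I_ell.+1 -> F} * {ffun 'I_t -> F}) :
    option typeI :=
  if pselect (exists x, typeI_code x == c) is left ex then Some (xchoose ex)
  else None.

Fact typeI_codeK : pcancel typeI_code typeI_decode.
Proof.
move=> x; rewrite /typeI_decode; case: pselect => [ex|[]]; last by exists x.
by congr Some; apply: typeI_code_inj; apply/eqP; exact: (xchooseP ex).
Qed.

HB.instance Definition _ : isCountable typeI := PCanIsCountable typeI_codeK.
HB.instance Definition _ : isFinite typeI := PCanIsFinite typeI_codeK.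

(* Left multiplication is injective on the finite type [typeI], so bijective. *)
Definition typeI_inv (x : typeI) : typeI := invF (@typeI_mulI x) typeI_one.

Fact typeI_mulV : left_inverse typeI_one typeI_inv typeI_mul.
Proof. by move=> x; rewrite typeI_mulC /typeI_inv (f_invF (@typeI_mulI x)). Qed.

HB.instance Definition _ :=
  Finite_isGroup.Build typeI typeI_mulA typeI_mul1 typeI_mulV.

(* [None] when [f] is not a monic polynomial with nonzero constant term. *)
Definition typeI_class (f : {poly F}) : option typeI :=
  omap \pi_typeI (insub f : option typeI_poly).

Lemma typeI_classM (f g : typeI_poly) :
  typeI_class ((f : {poly F}) * (g : {poly F})) = Some (\pi_typeI f * \pi_typeI g)%g.
Proof.
by rewrite /typeI_class (insubT typeI_dom (typeI_mul_proof f g)) /= -typeI_piM.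
Qed.

Lemma typeI_classE (f g : typeI_poly) :
  (typeI_class f == typeI_class g) = typeI_eqv f g.
Proof. by rewrite /typeI_class !valK -typeI_piE. Qed.

End TypeIGroup.

(* The group algebra, with the convolution product. *)
Definition galg (K : fieldType) (gT : finGroupType) : Type := {ffun gT -> K^o}.

Section GroupAlgebra.
Variables (K : fieldType) (gT : finGroupType).

HB.instance Definition _ := GRing.Lmodule.copy (galg K gT) {ffun gT -> K^o}.

Definition gcoef (a : galg K gT) (x : gT) : K := (a : {ffun gT -> K^o}) x.
Definition gbase (x : gT) : galg K gT := [ffun y => (y == x)%:R].
Definition gmul (a b : galg K gT) : galg K gT :=
  [ffun x => \sum_(y : gT) gcoef a y * gcoef b (y^-1 * x)%g].

Let gP (a b : galg K gT) : (forall x, gcoef a x = gcoef b x) -> a = b.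
Proof. by move=> H; apply/ffunP. Qed.
Let gD (a b : galg K gT) x : gcoef (a + b) x = gcoef a x + gcoef b x.
Proof. exact: ffunE. Qed.
Let gM (a b : galg K gT) x :
  gcoef (gmul a b) x = \sum_(y : gT) gcoef a y * gcoef b (y^-1 * x)%g.
Proof. exact: ffunE. Qed.
Let g1 x y : gcoef (gbase x) y = (y == x)%:R.
Proof. exact: ffunE. Qed.

Fact gmulA : associative gmul.
Proof.
move=> a b c; apply: gP => x; rewrite !gM.
under eq_bigr do rewrite gM mulr_sumr.
under [RHS]eq_bigr do rewrite gM mulr_suml.
rewrite [RHS]exchange_big /=; apply: eq_bigr => y _.
rewrite [RHS](reindex_inj (mulgI y)); apply: eq_bigr => z _.
by rewrite mulKg invMg !mulgA mulrA.
Qed.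

Fact gmul1r : left_id (gbase 1%g) gmul.
Proof.
move=> a; apply: gP => x; rewrite gM (bigD1 1%g) //= g1 eqxx mul1r invg1 mul1g.
by rewrite big1 ?addr0 // => y /negPf y1; rewrite g1 y1 mul0r.
Qed.

Fact gmulr1 : right_id (gbase 1%g) gmul.
Proof.
move=> a; apply: gP => x; rewrite gM (bigD1 x) //= g1 mulVg eqxx mulr1.
rewrite big1 ?addr0 // => y yx; rewrite g1 -eq_mulVg1 (negPf yx).
by rewrite mulr0.
Qed.

Fact gmulDl : left_distributive gmul +%R.
Proof.
move=> a b c; apply: gP => x; rewrite gD !gM -big_split /=.
by apply: eq_bigr => y _; rewrite gD mulrDl.
Qed.

Fact gmulDr : right_distributive gmul +%R.
Proof.
move=> a b c; apply: gP => x; rewrite gD !gM -big_split /=.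
by apply: eq_bigr => y _; rewrite gD mulrDr.
Qed.

Fact gbase1_neq0 : gbase 1%g != 0.
Proof.
apply/eqP => /(congr1 (gcoef^~ 1%g)); rewrite g1 eqxx => /eqP.
by rewrite /gcoef ffunE oner_eq0.
Qed.

HB.instance Definition _ := GRing.Zmodule_isNzRing.Build (galg K gT)
  gmulA gmul1r gmulr1 gmulDl gmulDr gbase1_neq0.

Fact gscaleAl (k : K) (a b : galg K gT) : k *: (a * b) = (k *: a) * b.
Proof.
have gZ (c : galg K gT) x : gcoef (k *: c) x = k * gcoef c x by exact: ffunE.
apply: gP => x; rewrite gZ !gM mulr_sumr.
by apply: eq_bigr => y _; rewrite gZ mulrA.
Qed.

HB.instance Definition _ := GRing.Lmodule_isLalgebra.Build K (galg K gT) gscaleAl.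

End GroupAlgebra.

(* Formal power series over [A] are coefficient sequences [nat -> A]. *)
Section PowerSeries.
Variables (K : fieldType) (A : lalgType K).

Definition ps_one : nat -> A := fun n => (n == 0)%:R.
Definition ps_mul (a b : nat -> A) : nat -> A :=
  fun n => \sum_(i < n.+1) a i * b (n - i)%N.
Definition ps_exp (a : nat -> A) (k : nat) : nat -> A :=
  iter k (ps_mul a) ps_one.

(* [ln a = sum_(k >= 1) (-1)^(k+1) / k (a - 1)^k] for [a] with constant term
   [1]; then [(a - 1)^k] has no term of degree less than [k]. *)
Definition ps_ln (a : nat -> A) : nat -> A := fun n =>
  \sum_(1 <= k < n.+1)
    ((-1) ^+ k.+1 / k%:R) *: ps_exp (fun i => a i - ps_one i) k n.

End PowerSeries.

Definition mobius (n : nat) : int :=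
  if all (fun p => logn p n == 1%N) (primes n) then (-1) ^+ size (primes n)
  else 0.

(* [exp(2 pi sqrt(-1) / n)] *)
Definition omega (R : realType) (n : nat) : R[i] :=
  (cos (2 * pi / n%:R) +i* sin (2 * pi / n%:R))%C.

(* The roots of a nonzero polynomial, listed with multiplicity. *)
Definition root_mset (C : closedFieldType) (p : {poly C}) : seq C :=
  sval (closed_field_poly_normal p).

Definition monics (F : finFieldType) (d : nat) : {set {poly_d.+1 F}} :=
  [set f : {poly_d.+1 F} | ((f : {poly F}) \is monic) && (size f == d.+1)].

Section Counting.
Variables (R : realType) (F : finFieldType) (ell t : nat).
Local Notation E := (typeI F ell t).
Local Notation C := R[i].

(* The class of [f] in the group algebra, read as [0] when [f.[0] = 0]. *)
Definition angle (f : {poly F}) : galg C E :=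
  if typeI_class ell t f is Some e then gbase C e else 0.

(* Coefficient of [z^d] in the sum of [angle f * z^(deg f)] over monic [f]. *)
Definition genF : nat -> galg C E := fun d => \sum_(f in monics F d) angle f.

(* [n [z^n e] ln F(z)] *)
Definition Ncoef (n : nat) (e : E) : C := n%:R * gcoef (ps_ln genF n) e.

Definition Icount (d : nat) (e : E) : nat :=
  #|[set f in monics F d | irreducibleb f & typeI_class ell t f == Some e]|.

Definition classes_deg (d : nat) : {set E} :=
  [set e : E | [exists f in monics F d, typeI_class ell t f == Some e]].

Variables (m : nat) (xi : 'I_m -> E).

(* The index set [[r_1] x ... x [r_m]] with [r_i = #[xi i]]; the entry in
   position [i] is [ent s i], which ranges over [1, ..., r_i]. *)
Definition idx : finType := {dffun forall i : 'I_m, 'I_(#[xi i]%g)}.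
Definition ent (s : idx) (i : 'I_m) : nat := (s i).+1.

Definition elt_of (v : 'I_m -> nat) : E := (\prod_(i < m) xi i ^+ v i)%g.

(* The index [r = (r_1, ..., r_m)], removed from [idx] to obtain [J]. *)
Definition is_top (j : idx) : bool := [forall i, ent j i == #[xi i]%g].

(* When [E] is the internal direct product of the [<[xi i]>], the exponent
   vector [v] of [e] exists and is unique. *)
Definition chi (j : idx) (e : E) : C :=
  if [pick v : idx | elt_of (ent v) == e] is Some v
  then \prod_(i < m) omega R #[xi i]%g ^+ (ent v i * ent j i)%N else 0.

Definition ccoef (d : nat) (j : idx) : C := \sum_(e in classes_deg d) chi j e.

Definition Ppoly (j : idx) : {poly C} :=
  1 + \sum_(1 <= k < (ell + t - 1).+1) ccoef k j *: 'X^k.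

End Counting.

(* Main.v *)
(** Each character [chi] of the finite abelian group of classes extends to the
    group algebra and turns [ln F(z)] into the logarithm of the scalar series
    [sum_f chi<f> z^(deg f)], so that [N_n] is recovered by Fourier inversion.
    That series is [(1 - z) / (1 - q z)] for the trivial character. For a
    nontrivial one it is the polynomial [P_j]: in degree [d <= tau] a class
    contains at most one monic polynomial of degree [d], and in degree
    [d > tau] all classes contain equally many, so the coefficient vanishes.
    On the other hand the Euler product, in the logarithmic form
    [deg f = sum_(P^k | f) deg P], expresses [N_n] through the numbers of
    irreducible polynomials, and Moebius inversion gives [I_d]. *)
Require Import Defs.
From HB Require Import structures.
From mathcomp Require Import all_boot all_order all_algebra all_fingroup.
From mathcomp Require Import cyclic lra.
From mathcomp Require Import boolp reals trigo complex.

Set Implicit Arguments.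
Unset Strict Implicit.
Unset Printing Implicit Defensive.

Import GRing.Theory.
Local Open Scope ring_scope.

(** * Logarithmic derivatives of power series *)

Section PowerSeries.
Variable K : fieldType.
Implicit Types (a b c L : nat -> K^o) (p : {poly K}).

(** Series are handled modulo [z^(N+1)] as polynomials, so that the ring laws of [{poly K}] transfer
    to coefficient sequences degree by degree. *)
Definition trunc N a : {poly K} := \poly_(i < N.+1) a i.

Lemma coef_trunc N a n : (n <= N)%N -> (trunc N a)`_n = a n.
Proof. by move=> nN; rewrite coef_poly ltnS nN. Qed.

Lemma coefM_cong N (p p' q q' : {poly K}) :
    (forall i, (i <= N)%N -> p`_i = p'`_i) ->
    (forall i, (i <= N)%N -> q`_i = q'`_i) ->
  forall i, (i <= N)%N -> (p * q)`_i = (p' * q')`_i.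
Proof.
move=> pp' qq' i iN; rewrite !coefM; apply: eq_bigr => j _.
by rewrite pp' ?qq' // (leq_trans _ iN) ?leq_subr // -ltnS.
Qed.

Lemma ps_mulE N a b n : (n <= N)%N -> ps_mul a b n = (trunc N a * trunc N b)`_n.
Proof.
move=> nN; rewrite coefM; apply: eq_bigr => i _.
by rewrite !coef_trunc // (leq_trans _ nN) ?leq_subr // -ltnS.
Qed.

Lemma ps_mul_coef (p q : {poly K}) n :
  ps_mul (fun i => p`_i : K^o) (fun i => q`_i) n = (p * q)`_n.
Proof. by rewrite coefM. Qed.

Lemma ps_mulC a b n : ps_mul a b n = ps_mul b a n.
Proof. by rewrite !(ps_mulE _ _ (leqnn n)) mulrC. Qed.

Lemma ps_mulA a b c n : ps_mul a (ps_mul b c) n = ps_mul (ps_mul a b) c n.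
Proof.
rewrite !(ps_mulE _ _ (leqnn n)); set A := trunc n a; set C := trunc n c.
transitivity ((A * (trunc n b * C))`_n).
  apply: (coefM_cong (N := n)) => // i iN.
  by rewrite coef_trunc // (ps_mulE _ _ iN).
rewrite mulrA; apply: (coefM_cong (N := n)) => // i iN.
by rewrite coef_trunc // (ps_mulE _ _ iN).
Qed.

Lemma eq_ps_mul a a' b b' : a =1 a' -> b =1 b' -> ps_mul a b =1 ps_mul a' b'.
Proof. by move=> aa bb n; apply: eq_bigr => i _; rewrite aa bb. Qed.

Lemma ps_expE N a k n : (n <= N)%N -> ps_exp a k n = (trunc N a ^+ k)`_n.
Proof.
elim: k n => [|k IH] n nN; first by rewrite expr0 coef1.
rewrite exprS (_ : ps_exp a k.+1 n = ps_mul a (ps_exp a k) n) //.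
rewrite (ps_mulE _ _ nN); apply: (coefM_cong _ _ nN) => // i iN.
by rewrite coef_trunc // IH.
Qed.

(* The coefficients of [z a'(z) / a(z)]. *)
Definition logderiv a : nat -> K^o := fun n => n%:R * ps_ln a n.

Lemma eq_ps_exp a b k : a =1 b -> ps_exp a k =1 ps_exp b k.
Proof. by move=> ab; elim: k => //= k IH n; apply: eq_ps_mul. Qed.

Lemma eq_ps_ln a b : a =1 b -> ps_ln a =1 ps_ln b.
Proof.
move=> ab n; apply: eq_bigr => k _; congr (_ *: _).
by apply: eq_ps_exp => i; rewrite ab.
Qed.

Lemma eq_logderiv a b : a =1 b -> logderiv a =1 logderiv b.
Proof. by move=> ab n; rewrite /logderiv (eq_ps_ln ab). Qed.

Hypothesis K0 : [pchar K] =i pred0.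

Lemma coefXderiv p n : ('X * p^`())`_n = n%:R * p`_n.
Proof. by case: n => [|n]; rewrite coefXM ?mul0r // coef_deriv mulr_natl. Qed.

Lemma coef_exp_low p n k : p`_0 = 0 -> (n < k)%N -> (p ^+ k)`_n = 0.
Proof.
move=> p0 nk; have -> : p = 'X * drop_poly 1 p.
  apply/polyP => -[|i]; rewrite coefXM ?p0 //=.
  by rewrite coef_drop_poly addn1.
by rewrite exprMn coefXnM nk.
Qed.

(* With [a = 1 + u], differentiating [ln a] gives [u' / (1 + u)] as a geometric
   series, whose error term [u^N] is invisible in degree [n < N]. *)
Lemma logderivP a n : a 0%N = 1 -> ps_mul (logderiv a) a n = n%:R * a n.
Proof.
move=> a0; pose N := n.+1; pose u : nat -> K^o := fun i => a i - ps_one _ i.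
pose U := trunc N u.
have U0 : U`_0 = 0 by rewrite coef_trunc // /u a0 subrr.
pose T := \sum_(1 <= k < N.+1) ((-1) ^+ k.+1 / k%:R) *: U ^+ k.
have lnE i : (i <= n)%N -> logderiv a i = ('X * T^`())`_i.
  move=> iN; rewrite coefXderiv /logderiv; congr (_ * _).
  (* [ps_ln a i] stops at exponent [i] while [T] runs to [N]; the extra powers of [U] have no term
     in degree [i]. *)
  rewrite coef_sum /ps_ln [RHS](big_cat_nat (n := i.+1)) //=; last by rewrite ltnS leqW.
  rewrite [X in _ = _ + X]big_nat_cond [X in _ = _ + X]big1 ?addr0; last first.
    by move=> k /andP[/andP[ik _] _]; rewrite coefZ coef_exp_low ?mulr0.
  by apply: eq_bigr => k _; rewrite coefZ (@ps_expE N) // (leq_trans iN).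
have aE i : (i <= n)%N -> a i = (1 + U)`_i.
  move=> iN; rewrite coefD coef1 coef_trunc ?(leq_trans iN) //.
  by rewrite /u /ps_one addrC subrK.
have dT : T^`() = U^`() * \sum_(k < N) (- U) ^+ k.
  rewrite raddf_sum /= big_add1 /= big_mkord mulr_sumr; apply: eq_bigr => k _.
  (* The factor [k + 1] from differentiation cancels the denominator in the logarithm, by
     characteristic 0; the signs combine into [(- U) ^+ k]. *)
  rewrite derivZ deriv_exp /= -(scaler_nat k.+1 (_ * _)) scalerA.
  rewrite mulrAC -mulrA mulfV ?mulr1; last first.
    by move/pcharf0P: K0 => ->.
  by rewrite -[- U]scaleN1r exprZn -scalerAr !exprS !mulN1r opprK.
have geo : (1 + U) * \sum_(k < N) (- U) ^+ k = 1 - (- U) ^+ N.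
  by rewrite -[RHS]opprB subrX1 -mulNr opprB opprK.
transitivity (('X * T^`()) * (1 + U))`_n.
  rewrite coefM; apply: eq_bigr => i _; rewrite lnE; last by rewrite -ltnS.
  by rewrite aE ?leq_subr.
rewrite dT -!mulrA [X in _ * (_ * X)]mulrC geo mulrA mulrBr mulr1 coefB.
have -> : ('X * U^`() * (- U) ^+ N)`_n = 0.
  rewrite coefM big1 // => i _.
  rewrite [X in _ * X](coef_exp_low _ (_ : _ < N)%N) ?mulr0 //.
    by rewrite coefN U0 oppr0.
  by rewrite ltnS leq_subr.
rewrite subr0 coefXderiv aE // coefD coef1.
by case: (n) => [|i]; rewrite ?mul0r //= add0r.
Qed.

(** As [a 0 = 1], coefficient [n] of the product is [L n] plus terms in earlier coefficients of [L],
    so strong induction recovers [L]. *)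
Lemma ps_mul_cancel a L L' : a 0%N = 1 ->
  (forall n, ps_mul L a n = ps_mul L' a n) -> L =1 L'.
Proof.
move=> a0 H n; elim/ltn_ind: n => n IH.
have := H n; rewrite /ps_mul !big_ord_recr /= subnn a0 !mulr1.
rewrite (eq_bigr (fun i : 'I_n => L' i * a (n - i)%N)); first exact: addrI.
by move=> i _; rewrite IH.
Qed.

Lemma logderiv_unique a L : a 0%N = 1 ->
  (forall n, ps_mul L a n = n%:R * a n) -> logderiv a =1 L.
Proof.
move=> a0 H; apply: (ps_mul_cancel a0) => n.
by rewrite H logderivP.
Qed.

(** The Leibniz rule: on the term [a_i b_(n-i)] the weights [i] and [n - i] add up to [n]. *)
Lemma logderivM a b n : a 0%N = 1 -> b 0%N = 1 ->
  logderiv (ps_mul a b) n = logderiv a n + logderiv b n.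
Proof.
move=> a0 b0; apply: (@logderiv_unique _ (fun n => logderiv a n + logderiv b n)).
  by rewrite /ps_mul big_ord1 a0 b0 mulr1.
move=> {}n; transitivity
  (ps_mul (ps_mul (logderiv a) a) b n + ps_mul a (ps_mul (logderiv b) b) n).
  rewrite -ps_mulA; rewrite [X in _ = _ + X]ps_mulC -ps_mulA.
  rewrite -[RHS]/(_ + _) [X in _ = _ + X](eq_ps_mul (frefl _) (ps_mulC b a)).
  by rewrite -big_split /=; apply: eq_bigr => i _; rewrite mulrDl.
rewrite (eq_ps_mul (a' := fun i => i%:R * a i) (b' := b)) //; last first.
  by move=> i; rewrite logderivP.
rewrite [X in _ + X](eq_ps_mul (a' := a) (b' := fun i => i%:R * b i)) //; last first.
  by move=> i; rewrite logderivP.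
rewrite -big_split /= mulr_sumr; apply: eq_bigr => i _.
by rewrite mulrCA -mulrA -mulrDl -natrD subnKC // -ltnS.
Qed.

Lemma logderiv1 n : logderiv (ps_one _) n = 0.
Proof.
apply: (logderiv_unique (L := fun=> 0)) => // k.
rewrite /ps_mul big1 => [|i _]; last by rewrite mul0r.
by case: k => [|k]; rewrite ?mul0r // mulr0.
Qed.

Lemma logderiv_linear (r : K) n : (0 < n)%N ->
  logderiv (fun i => (1 - r *: 'X : {poly K})`_i) n = - r ^+ n.
Proof.
(* The geometric series of [- r z / (1 - r z)] has no constant term, so degree 0 is exempted from
   the formula [- r ^+ i]. *)
move=> n0; pose L i : K^o := if i == 0%N then 0 else - r ^+ i.
rewrite (@logderiv_unique _ L); first by rewrite /L gtn_eqF.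
  by rewrite coefB coef1 coefZ coefX mulr0 subr0.
move=> k; rewrite ps_mulC /ps_mul.
have cE i : (1 - r *: 'X : {poly K})`_i = (i == 0)%:R - r * (i == 1)%:R.
  by rewrite coefB coef1 coefZ coefX.
rewrite cE; under eq_bigr do rewrite cE.
case: k => [|k]; first by rewrite big_ord1 /L mulr0 mul0r.
rewrite big_ord_recl big_ord_recl big1 => [|i _]; last first.
  by rewrite /= ?mulr0n mulr0 subr0; exact: mul0r.
rewrite /= subn0 !mulr0 !mulr1 subr0 mul1r sub0r addr0 /bump /= subSS subn0.
rewrite /L /=; case: k => [|k] /=.
  by rewrite mulr0 addr0 expr1 mul1r mulr1 sub0r.
by rewrite !mulr0 subrr mulr0 mulrNN -exprS addNr.
Qed.

Lemma logderiv_prod (s : seq K) n : (0 < n)%N ->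
  logderiv (fun i => (\prod_(r <- s) (1 - r *: 'X) : {poly K})`_i) n =
    - \sum_(r <- s) r ^+ n.
Proof.
have c0 r : (1 - r *: 'X : {poly K})`_0 = 1.
  by rewrite coefB coef1 coefZ coefX mulr0 subr0.
move=> n0; elim: s => [|r s IH].
  rewrite [in RHS]big_nil oppr0 -[RHS](logderiv1 n); apply: eq_logderiv => i.
  by rewrite big_nil coef1.
rewrite [in RHS]big_cons opprD -logderiv_linear // -IH -logderivM //.
- by apply: eq_logderiv => i; rewrite big_cons ps_mul_coef.
- rewrite -horner_coef0 horner_prod big1 // => i _; by rewrite horner_coef0.
Qed.

(** Normalised by [p(0) = 1], [p] is the product of the factors [1 - X / z] over its roots [z], and
    each factor contributes a geometric series. *)
Lemma logderiv_roots (p : {poly K}) (s : seq K) n : (0 < n)%N -> p`_0 = 1 ->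
    p = lead_coef p *: \prod_(z <- s) ('X - z%:P) ->
  logderiv (fun i => p`_i) n = - \sum_(z <- s) z ^- n.
Proof.
move=> n0 p0 pE; have s0 z : z \in s -> z != 0.
  apply: contraTneq => -> ; apply/negP => z0; move: p0; rewrite -horner_coef0 pE.
  rewrite hornerZ horner_prod (big_rem _ z0) /= hornerXsubC subrr mul0r mulr0.
  by move/eqP; rewrite eq_sym oner_eq0.
have : p = \prod_(r <- [seq z^-1 | z <- s]) (1 - r *: 'X).
  have -> : \prod_(r <- [seq z^-1 | z <- s]) (1 - r *: 'X) =
     (\prod_(z <- s) - z^-1) *: \prod_(z <- s) ('X - z%:P).
    rewrite big_map -scaler_prod; apply: eq_big_seq => z /s0 z0.
    by rewrite scalerBr -!mul_polyC -[in RHS]polyCM mulNr mulVf // addrC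
      !polyCN polyC1 opprK mulNr.
  (* Evaluation at 0 gives [lead_coef p] times the product of the [- z] equal to 1, which determines
     the leading coefficient. *)
  rewrite {1}pE; congr (_ *: _); move: p0; rewrite -horner_coef0 pE.
  rewrite hornerZ horner_prod => p0.
  rewrite lead_coefZ (monicP (monic_prod_XsubC _ _ _)) mulr1.
  move/(congr1 ( *%R^~ (\prod_(z <- s) - z^-1))): p0.
  rewrite mul1r -mulrA -big_split /= big1_seq ?mulr1 // => z /s0 z0.
  by rewrite hornerXsubC sub0r mulrNN mulfV.
move=> pE'; have /eq_logderiv -> : (fun i => p`_i : K^o) =1
    fun i => (\prod_(r <- [seq z^-1 | z <- s]) (1 - r *: 'X))`_i.
  by move=> i; rewrite -pE'.
rewrite logderiv_prod // big_map.
by congr (- _); apply: eq_bigr => z _; rewrite exprVn.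
Qed.

End PowerSeries.

(** * Moebius inversion *)

Section DivisorSums.
Variables (V : nmodType) (n : nat).
Hypothesis n0 : (0 < n)%N.

Lemma perm_divisors_mul k : (k %| n)%N ->
  perm_eq [seq (k * l)%N | l <- divisors (n %/ k)]
          [seq d <- divisors n | (k %| d)%N].
Proof.
move=> kn; have k0 : (0 < k)%N := dvdn_gt0 n0 kn.
have nk0 : (0 < n %/ k)%N by rewrite divn_gt0 // dvdn_leq.
apply: uniq_perm.
- rewrite map_inj_uniq ?divisors_uniq // => x y /eqP.
  by rewrite eqn_pmul2l // => /eqP.
- by rewrite filter_uniq // divisors_uniq.
move=> x; rewrite mem_filter -dvdn_divisors //; apply/mapP/andP.
  move=> [l]; rewrite -dvdn_divisors // => ln ->; rewrite dvdn_mulr //.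
  by rewrite -(divnK kn) mulnC dvdn_pmul2r.
move=> [kx xn]; exists (x %/ k)%N; last by rewrite mulnC divnK.
by rewrite -dvdn_divisors // -(dvdn_pmul2r k0) !divnK.
Qed.

(** Regrouping by [d = k l]: for fixed [k] these are the multiples of [k] dividing [n], and the two
    sums are then exchanged. *)
Lemma sum_divisors_mul (G : nat -> nat -> V) :
  \sum_(k <- divisors n) \sum_(l <- divisors (n %/ k)) G k (k * l)%N =
  \sum_(d <- divisors n) \sum_(k <- divisors d) G k d.
Proof.
transitivity (\sum_(k <- divisors n) \sum_(d <- divisors n | (k %| d)%N) G k d).
  apply: eq_big_seq => k; rewrite -dvdn_divisors // => kn.
  rewrite -[RHS]big_filter -(perm_big _ (perm_divisors_mul kn)).
  by rewrite big_map.
rewrite (exchange_big_dep predT) //=; apply: eq_big_seq => d.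
rewrite -dvdn_divisors // => dn; rewrite -big_filter; apply: perm_big.
apply: uniq_perm; rewrite ?filter_uniq ?divisors_uniq // => k.
rewrite mem_filter -!dvdn_divisors //; last exact: dvdn_gt0 dn.
by apply/andP/idP => [[]|kd] //; rewrite kd (dvdn_trans kd dn).
Qed.

End DivisorSums.

(** If [p] divides [k], then [p^2] divides [p k]; otherwise exactly one prime, of exponent 1, is
    added. *)
Lemma mobius_mul_prime p k : prime p -> (0 < k)%N ->
  mobius (p * k) = if (p %| k)%N then 0 else - mobius k.
Proof.
move=> pp k0; have p0 := prime_gt0 pp; rewrite /mobius; case: (boolP (p %| k)%N) => pk.
  have pm : p \in primes (p * k) by rewrite mem_primes pp muln_gt0 p0 k0 dvdn_mulr.
  case: ifP => // /allP/(_ p pm); rewrite lognM // logn_prime // eqxx eqSS => /eqP lk.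
  have : (0 < logn p k)%N by rewrite logn_gt0 mem_primes pp k0 pk.
  by rewrite lk.
have mem_pk : perm_eq (primes (p * k)) (p :: primes k).
  apply: uniq_perm; rewrite ?primes_uniq //= ?primes_uniq ?andbT.
    by rewrite mem_primes (negbTE pk) !andbF.
  by move=> x; rewrite primesM // primes_prime // !inE.
rewrite (perm_all _ mem_pk) (perm_size mem_pk) /= lognM // logn_prime // eqxx.
have -> : logn p k = 0%N.
  by apply/eqP; rewrite -leqn0 leqNgt logn_gt0 mem_primes (negbTE pk) !andbF.
rewrite addn0 eqxx /=; have -> : all (fun q => logn q (p * k) == 1%N) (primes k) =
    all (fun q => logn q k == 1%N) (primes k).
  apply: eq_in_all => x xk; rewrite lognM // logn_prime //.
  case: (x =P p) xk => [->|_ _]; last by [].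
  by rewrite mem_primes (negbTE pk) !andbF.
by case: ifP; rewrite ?oppr0 // exprS mulN1r.
Qed.

(** Fix a prime [p] dividing [n]. The divisors [p l] contribute 0 when [p] divides [l] and
    [- mobius l] otherwise, cancelling the divisors prime to [p], which already divide [n / p]. *)
Lemma sum_mobius n : (0 < n)%N -> \sum_(k <- divisors n) mobius k = (n == 1%N)%:R.
Proof.
move=> n0; case: eqP => [->|/eqP n1]; first by rewrite big_seq1.
pose p := pdiv n; have pp : prime p by rewrite pdiv_prime // ltn_neqAle eq_sym n1.
have pn : (p %| n)%N := pdiv_dvd n; have p0 := prime_gt0 pp.
rewrite (bigID (fun k => p %| k)%N) /= -big_filter.
rewrite -(perm_big _ (perm_divisors_mul n0 pn)) big_map.
have np0 : (0 < n %/ p)%N by rewrite divn_gt0 // dvdn_leq.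
rewrite (eq_big_seq (fun k => if (p %| k)%N then 0 else - mobius k)); last first.
  move=> k; rewrite -dvdn_divisors // => kn.
  by rewrite mobius_mul_prime // (dvdn_gt0 _ kn).
rewrite -[X in _ + X]big_filter (bigID (fun k => p %| k)%N) /= big1 ?add0r => [|k ->] //.
rewrite (eq_bigr (fun k => - mobius k)) => [|k /negbTE ->] //.
have E : perm_eq [seq k <- divisors (n %/ p) | ~~ (p %| k)%N]
                 [seq k <- divisors n | ~~ (p %| k)%N].
  apply: uniq_perm; rewrite ?filter_uniq ?divisors_uniq // => k.
  rewrite !mem_filter -!dvdn_divisors //; case pk: (p %| k)%N => //=.
  by rewrite -{2}(divnK pn) Gauss_dvdl // coprime_sym prime_coprime // pk.
by rewrite sumrN -[X in - X]big_filter (perm_big _ E) addNr.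
Qed.

(** * Monic polynomials and their classes *)

Section MonicPolynomials.
Variable F : finFieldType.
Implicit Types (f g P : {poly F}).

(** A list of plain polynomials, so that products and quotients of different degrees stay in one
    type. *)
Definition monic_seq d : seq {poly F} :=
  [seq (f : {poly F}) | f : {poly_d.+1 F} <- enum (monics F d)].

Lemma mem_monic_seq d f : (f \in monic_seq d) = (f \is monic) && (size f == d.+1).
Proof.
apply/mapP/andP => [[g]|[mf /eqP sf]].
  by rewrite mem_enum inE => /andP[] ? ? ->.
have sfd : (size f <= d.+1)%N by rewrite sf.
exists (npolyp d.+1 f); last by rewrite /= npolypK.
by rewrite mem_enum inE npolypK // mf sf eqxx.
Qed.

Lemma monic_seq_uniq d : uniq (monic_seq d).
Proof. by rewrite map_inj_uniq ?enum_uniq //; exact: val_inj. Qed.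

Lemma big_monics (V : nmodType) d (G : {poly F} -> V) (Q : pred {poly F}) :
  \sum_(f in monics F d | Q f) G f = \sum_(f <- monic_seq d | Q f) G f.
Proof. by rewrite big_map big_enum_cond. Qed.

Lemma monic_seq0 : perm_eq (monic_seq 0) [:: 1].
Proof.
apply: uniq_perm => //; first exact: monic_seq_uniq.
move=> f; rewrite mem_monic_seq inE; apply/andP/eqP => [[mf sf]|->].
  have /size_poly1P[c _ fc] := sf; move: mf; rewrite fc monicE lead_coefC.
  by move/eqP->.
by rewrite monic1 size_poly1.
Qed.

Lemma size_monic_seq d : size (monic_seq d) = (#|F| ^ d)%N.
Proof.
have -> : size (monic_seq d) = size [seq 'X^d + val u | u : {poly_d F}].
  apply/perm_size/uniq_perm; first exact: monic_seq_uniq.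
    rewrite map_inj_uniq ?enum_uniq // => u v /addrI; exact: val_inj.
  move=> f; rewrite mem_monic_seq; apply/andP/mapP => [[mf /eqP sf]|[u _ ->]].
    exists (npolyp d (f - 'X^d)); first by rewrite mem_enum.
    rewrite /= npolypK; first by rewrite (addrC 'X^d) subrK.
    apply/leq_sizeP => j.
    rewrite leq_eqVlt coefB coefXn => /orP[/eqP<-|dj].
      by rewrite eqxx -(monicP mf) lead_coefE sf subrr.
    by rewrite (gtn_eqF dj) nth_default ?subrr // sf.
  have su : (size (val u) < size ('X^d : {poly F}))%N.
    by rewrite size_polyXn ltnS size_npoly.
  by rewrite monicE lead_coefDl // lead_coefXn size_polyDl // size_polyXn.
by rewrite size_map -cardE card_npoly.
Qed.

(** The monic polynomials with zero constant term are [X] times the monic ones of one degree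
    less. *)
Lemma count_monic_coef0 d :
  count (fun f => f.[0] != 0) (monic_seq d.+1) = (#|F| ^ d.+1 - #|F| ^ d)%N.
Proof.
have := count_predC (fun f => f.[0] == 0) (monic_seq d.+1).
rewrite size_monic_seq => <-; suff -> : count (fun f : {poly F} => f.[0] == 0) (monic_seq d.+1) =
    (#|F| ^ d)%N by rewrite addKn.
rewrite -size_monic_seq -(size_map (fun f => 'X * f)) -size_filter; apply/perm_size/uniq_perm.
- by rewrite filter_uniq ?monic_seq_uniq.
- rewrite map_inj_uniq ?monic_seq_uniq //; by apply: mulfI; rewrite polyX_eq0.
move=> f; rewrite mem_filter mem_monic_seq.
apply/andP/mapP => [[f0 /andP[mf /eqP sf]]|[g]].
  have [g fE] : exists g, f = g * 'X.
    exists (drop_poly 1 f); apply/polyP => -[|i].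
      by rewrite coefMX /= -horner_coef0 (eqP f0).
    rewrite coefMX /=.
    by rewrite coef_drop_poly addn1.
  exists g; last by rewrite mulrC.
  move: mf sf; rewrite fE mem_monic_seq monicMr ?monicX // => mg.
  by rewrite mg size_mulX ?monic_neq0 // => -[->]; rewrite eqxx.
rewrite mem_monic_seq => /andP[mg /eqP sg] ->.
rewrite hornerM hornerX mul0r eqxx monicMl ?monicX // mg.
by rewrite mulrC size_mulX ?monic_neq0 // sg eqxx.
Qed.

End MonicPolynomials.

(** * Type I classes within a fixed degree *)

Section TypeIClasses.
Variables (F : finFieldType) (ell t : nat).
Local Notation E := (typeI F ell t).
Local Notation cls := (typeI_class ell t).
Implicit Types (f g : {poly F}).

Lemma dvdp_XnP n f : reflect (forall i, (i < n)%N -> f`_i = 0) ('X^n %| f).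
Proof.
apply: (iffP idP) => [/dvdpP[g ->] i ni|f0]; first by rewrite coefMXn ni.
apply/modp_eq0P; rewrite -Pdiv.IdomainMonic.take_poly_modp; apply/polyP => i.
by rewrite coef_take_poly coef0; case: ifP => // /f0.
Qed.

Lemma typeI_eqvP (f g : typeI_poly F) :
  reflect ((forall i, (i <= ell)%N -> (recip f)`_i = (recip g)`_i) /\
           (forall i, (i < t)%N -> (f : {poly F})`_i = (g : {poly F})`_i))
    (typeI_eqv ell t f g).
Proof.
apply: (iffP andP) => -[a b].
  by split=> i; [move: a => /dvdp_XnP H | move: b => /dvdp_XnP H] => /H/eqP;
    rewrite coefB subr_eq0 => /eqP.
split; apply/dvdp_XnP => i; first by move/a; rewrite coefB => ->; rewrite subrr.
by move/b; rewrite coefB => ->; rewrite subrr.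
Qed.

Lemma typeI_class_dom f : isSome (cls f) = typeI_dom f.
Proof. by rewrite /typeI_class; case: insubP => [u -> _|/negbTE->]. Qed.

Lemma typeI_class_pi (f : typeI_poly F) : cls f = Some (\pi_E f)%qT.
Proof. by rewrite /typeI_class valK. Qed.

Lemma coef_recip n f i : size f = n.+1 ->
  (recip f)`_i = if (i <= n)%N then f`_(n - i) else 0.
Proof. by move=> sf; rewrite coef_poly sf ltnS. Qed.

(** In degree [n], coefficient [k] of the reciprocal is coefficient [n - k], so its first [ell + 1]
    coefficients become the indices from [n - ell] up; above [n] both sides are 0. *)
Lemma typeI_class_eqP n f g : f \in monic_seq F n -> g \in monic_seq F n ->
    typeI_dom f -> typeI_dom g ->
  reflect (forall i, (i < t)%N || (n <= i + ell)%N -> f`_i = g`_i)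
          (cls f == cls g).
Proof.
rewrite !mem_monic_seq => /andP[mf /eqP sf] /andP[mg /eqP sg] df dg.
rewrite (typeI_classE ell t (TypeIPoly df) (TypeIPoly dg)).
apply: (iffP (typeI_eqvP _ _)) => /= [[a b] i /orP[/b //|nie]|H].
  case: (leqP i n) => ni; last by rewrite !nth_default ?sf ?sg.
  have := a (n - i)%N; rewrite !(@coef_recip n) // leq_subr subKn //; apply.
  by rewrite leq_subLR.
split=> i ie; last by apply: H; rewrite ie.
rewrite !(@coef_recip n) //; case: ifP => // ni; apply: H.
by rewrite -leq_subLR subKn // ie orbT.
Qed.

(** Below degree [ell + t] the prescribed low and high ranges together cover all indices. *)
Lemma typeI_class_inj n f g : (n < ell + t)%N ->
    f \in monic_seq F n -> g \in monic_seq F n ->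
  typeI_dom f -> cls f = cls g -> f = g.
Proof.
move=> nlt fn gn df fg; have dg : typeI_dom g by rewrite -typeI_class_dom -fg typeI_class_dom.
have /typeI_class_eqP H : cls f == cls g by rewrite fg.
apply/polyP => i; apply: (H n) => //; case: ltnP => //= ti.
by rewrite -ltnS (leq_trans nlt) // addnC ltnW // ltnS leq_add2r.
Qed.

Hypothesis t_gt0 : (0 < t)%N.

(** From degree [ell + t] on, the low and high ranges are disjoint and can be prescribed
    independently. *)
Lemma typeI_class_rep n (e : E) : (ell + t <= n)%N ->
  exists2 f, f \in monic_seq F n & cls f = Some e.
Proof.
move=> en; pose g := (generic_quotient.repr e : typeI_poly F).
have /andP[mg g0] := typeI_valP g.
(* Low coefficients come from the representative and high ones from its reciprocal, whatever its own
   degree; the gap is filled with zeros. *)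
pose c i := if (i < t)%N then (g : {poly F})`_i
  else if (n <= i + ell)%N then (recip g)`_(n - i) else 0.
pose f := \poly_(i < n.+1) c i.
have tn : (t <= n)%N by apply: leq_trans en; rewrite leq_addl.
have fn : f`_n = 1.
  rewrite coef_poly ltnSn /c ltnNge tn /= leq_addr subnn recip_at0.
  exact: monicP.
have sf : size f = n.+1.
  apply/eqP; rewrite eqn_leq size_poly ltnNge; apply/negP => /leq_sizeP/(_ n (leqnn n)).
  by rewrite fn => /eqP; rewrite oner_eq0.
have mf : f \is monic by rewrite monicE lead_coefE sf fn.
have df : typeI_dom f.
  by rewrite /typeI_dom mf horner_coef0 coef_poly /c t_gt0 -horner_coef0.
exists f; first by rewrite mem_monic_seq mf sf eqxx.
rewrite (typeI_class_pi (TypeIPoly df)) -[e]reprK; congr Some; apply/eqP.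
rewrite typeI_piE; apply/typeI_eqvP; split=> i ie /=.
  have ni : (i <= n)%N by rewrite (leq_trans ie) // (leq_trans _ en) ?leq_addr.
  rewrite (coef_recip _ sf) ni coef_poly ltnS leq_subr /c subKn //.
  rewrite ltnNge leq_subRL //; rewrite (_ : (i + t <= n)%N); last first.
    by rewrite (leq_trans _ en) // leq_add2r.
  by rewrite -leq_subLR subKn // ie.
by rewrite coef_poly /c ie ltnS ltnW // (leq_trans ie).
Qed.

(* The class of [f] in degree [n] consists of the polynomials [f + u X^t] with
   [size u <= n - (ell + t)]. *)
Lemma count_typeI_class n (e : E) : (ell + t <= n)%N ->
  count (fun f => cls f == Some e) (monic_seq F n) = (#|F| ^ (n - (ell + t)))%N.
Proof.
move=> en; have [f fn fe] := typeI_class_rep e en.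
have df : typeI_dom f by rewrite -typeI_class_dom fe.
set r := (n - _)%N; rewrite -card_npoly cardE.
rewrite -(size_map (fun u : {poly_r F} => f + val u * 'X^t)) -size_filter.
have /andP[mf /eqP sf] : (f \is monic) && (size f == n.+1) by rewrite -mem_monic_seq.
apply/perm_size/uniq_perm.
- by rewrite filter_uniq ?monic_seq_uniq.
- rewrite map_inj_uniq ?enum_uniq // => u v /addrI/mulIf uv.
  by apply/val_inj/uv; rewrite -size_poly_gt0 size_polyXn.
move=> g; rewrite mem_filter; apply/andP/mapP => [[/eqP ge gn]|[u _ ->]].
  have dg : typeI_dom g by rewrite -typeI_class_dom ge.
  have /(typeI_class_eqP fn gn df dg) fg : cls f == cls g by rewrite fe ge.
  exists (npolyp r (drop_poly t (g - f))); first by rewrite mem_enum.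
  rewrite /= npolypK; last first.
    apply/leq_sizeP => j rj; rewrite coef_drop_poly coefB fg ?subrr //.
    by move: rj; rewrite leq_subLR addnC addnA addnAC => ->; rewrite orbT.
  apply/polyP => i; rewrite coefD coefMXn; case: ifP => it.
    by rewrite addr0 fg ?it.
  by rewrite coef_drop_poly coefB subnK ?(addrC f`_i) ?subrK // leqNgt it.
(* This bound keeps the coefficients from index [n - ell] up unchanged, as the factor [X^t] does for
   the low ones. *)
have su : (size (val u * 'X^t)%R <= n - ell)%N.
  rewrite (leq_trans (size_polyMleq _ _)) // size_polyXn addnS /=.
  by rewrite (leq_trans (n := (r + t)%N)) ?leq_add2r ?size_npoly // /r subnDA subnK //
    leq_subRL // (leq_trans _ en) // leq_addr.
have suf : (size (val u * 'X^t)%R < size f)%N by rewrite sf ltnS (leq_trans su) ?leq_subr.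
have gn : f + val u * 'X^t \in monic_seq F n.
  by rewrite mem_monic_seq monicE lead_coefDl // size_polyDl // sf eqxx andbT -monicE.
rewrite -fe; split=> //; have dg : typeI_dom (f + val u * 'X^t).
  move: gn df; rewrite mem_monic_seq /typeI_dom => /andP[-> _] /andP[_].
  by rewrite hornerD hornerM hornerXn expr0n gtn_eqF // mulr0 addr0.
rewrite eq_sym; apply/(typeI_class_eqP fn gn df dg) => i /orP[it|ni].
  by rewrite coefD coefMXn it addr0.
by rewrite coefD [X in _ + X]nth_default ?addr0 // (leq_trans su) // leq_subLR addnC.
Qed.

Lemma sum_typeI_class (V : nmodType) (s : seq {poly F}) (psi : E -> V) :
  \sum_(f <- s) oapp psi 0 (cls f) =
  \sum_e psi e *+ count (fun f => cls f == Some e) s.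
Proof.
transitivity (\sum_(f <- s) \sum_e (if cls f == Some e then psi e else 0)).
  apply: eq_bigr => f _; rewrite -big_mkcond; case: (cls f) => [e|] /=.
    by rewrite (big_pred1 e) // => x; rewrite /= eq_sym.
  by rewrite big1.
rewrite exchange_big; apply: eq_bigr => e _ /=.
by rewrite -big_mkcond big_const_seq iter_addr_0.
Qed.

(** In degree exactly [ell + t] every class contains one monic polynomial, so the classes are
    counted by the monic polynomials with nonzero constant term. *)
Lemma card_typeI : #|E| = ((#|F| - 1) * #|F| ^ (ell + t - 1))%N.
Proof.
have [T TE] : exists T, (ell + t = T.+1)%N.
  by exists (ell + t).-1; rewrite prednK // addn_gt0 t_gt0 orbT.
rewrite TE subSS subn0 mulnBl mul1n -expnS -count_monic_coef0.
have -> : #|E| = (\sum_(e : E) 1%N *+ count (fun f => cls f == Some e) (monic_seq F T.+1))%R.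
  rewrite -sum1_card; apply: eq_bigr => e _.
  by rewrite count_typeI_class ?TE // subnn.
rewrite -sum_typeI_class -sum1_count [RHS]big_mkcond.
apply: eq_big_seq => f; rewrite mem_monic_seq => /andP[mf _].
have := typeI_class_dom f; rewrite /typeI_dom mf /=.
by case: (cls f) => [e|] /= <-.
Qed.

End TypeIClasses.

(** * Unique factorization and the Euler product *)

Section Factorization.
Variable F : finFieldType.
Implicit Types f g P Q : {poly F}.
Local Notation ms := (monic_seq F).

Lemma monic_seq_mul a b f g : f \in ms a -> g \in ms b -> f * g \in ms (a + b).
Proof.
rewrite !mem_monic_seq => /andP[mf /eqP sf] /andP[mg /eqP sg].
by rewrite monicMl // mg size_mul ?monic_neq0 // sf sg addSn addnS eqxx.
Qed.

Lemma monic_seq_exp a f k : f \in ms a -> f ^+ k \in ms (k * a).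
Proof.
move=> fa; elim: k => [|k IH]; last by rewrite exprS mulSn monic_seq_mul.
by rewrite expr0 mem_monic_seq monic1 size_poly1.
Qed.

Lemma monic_seq_divl a n f g : f \in ms a -> g * f \in ms n -> g \in ms (n - a).
Proof.
rewrite !mem_monic_seq => /andP[mf /eqP sf] /andP[].
rewrite monicMr // => mg; rewrite mg size_mul ?monic_neq0 // sf addnS /= => /eqP E.
have := size_poly_gt0 g; rewrite monic_neq0 //; case: (size g) E => // m.
by rewrite addSn => -[<-]; rewrite addnK eqxx.
Qed.

Lemma monic_seq_dvdp_leq a n f g : f \in ms a -> g \in ms n -> f %| g -> (a <= n)%N.
Proof.
rewrite !mem_monic_seq => /andP[mf /eqP sf] /andP[mg /eqP sg] /(dvdp_leq (monic_neq0 mg)).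
by rewrite sf sg.
Qed.

Lemma ex_irreducible_dvdp n f : f \in ms n -> (0 < n)%N ->
  exists d P, [/\ (0 < d)%N, P \in ms d, irreducibleb P & P %| f].
Proof.
elim/ltn_ind: n f => n IH f fn n0.
have [irr|] := boolP (irreducibleb f); first by exists n, f.
move: (fn); rewrite mem_monic_seq => /andP[mf /eqP sf].
rewrite negb_and sf ltnS n0 /= => /forallPn[q]; rewrite negb_imply -ltnNge -dvdpE.
move=> /andP[qf sq]; have q0 : (q : {poly F}) != 0 by rewrite -size_poly_gt0 ltnW.
have lq : (lead_coef q)^-1 != 0 by rewrite invr_eq0 lead_coef_eq0.
(* The divisor refuting irreducibility need not be monic; it is rescaled before the induction
   hypothesis applies. *)
have qm : (lead_coef q)^-1 *: (q : {poly F}) \in ms (size q).-1.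
  rewrite mem_monic_seq monicE lead_coefZ mulVf ?lead_coef_eq0 // eqxx size_scale //.
  by rewrite prednK ?eqxx // ltnW.
have [||d [P [d0 Pd irr Pq]]] := IH _ _ _ qm.
- by have := size_npoly q; move: sq; case: (size q).
- by move: sq; case: (size q) => // -[].
exists d, P; split=> //; apply: (dvdp_trans Pq).
by rewrite dvdpZl.
Qed.

Lemma irreducible_neq_coprime a b P Q : P \in ms a -> Q \in ms b ->
  irreducibleb P -> irreducibleb Q -> P != Q -> coprimep P Q.
Proof.
rewrite !mem_monic_seq => /andP[mP _] /andP[mQ _] /irreducibleP iP /irreducibleP iQ.
apply: contraNT; rewrite irreducible_poly_coprime // negbK => PQ.
rewrite -eqp_monic //; apply: (apply_irredp iQ) => //.
by case: iP => sP _; rewrite gtn_eqF.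
Qed.

(** The [P]-adic valuation of [f] once [N] is large enough ([P] nonconstant, [f] nonzero), written
    as a count so that it can be exchanged with sums over the exponent. *)
Definition mult_upto N P f := count (fun k => P ^+ k %| f) (iota 1 N).

(** For [P != Q], coprimality makes [Q] invisible to powers of [P]. For [P = Q] the exponents shift
    by one, and exponent 1 is the gain. *)
Lemma mult_upto_mul N a b n P Q g : P \in ms a -> Q \in ms b -> g \in ms n ->
    irreducibleb P -> irreducibleb Q -> (0 < a)%N -> (n < N)%N ->
  mult_upto N P (g * Q) = (mult_upto N P g + (P == Q))%N.
Proof.
move=> Pa Qb gn iP iQ a0 nN; rewrite /mult_upto; have [<-|PQ] := eqVneq P Q; last first.
  rewrite addn0; apply: eq_count => k; rewrite Gauss_dvdpl //.
  by rewrite coprimep_expl // (irreducible_neq_coprime Pa Qb).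
have P0 : P != 0 by apply: monic_neq0; move: Pa; rewrite mem_monic_seq => /andP[].
case: N nN => // N nN; rewrite -[in RHS](addn1 N) iotaD count_cat /= addn0.
(* The largest exponent is lost in the shift, but that power of [P] has degree above [n] and cannot
   divide [g]. *)
rewrite [X in (_ + nat_of_bool X + _)%N](_ : _ = false); last first.
  apply/negP => /(monic_seq_dvdp_leq (monic_seq_exp _ Pa) gn).
  rewrite leqNgt (leq_trans nN) // add1n; exact: leq_pmulr.
rewrite addn0 addn1 expr1 dvdp_mulIr add1n; congr S.
rewrite -[2%N]/(1 + 1)%N iotaDl count_map; apply: eq_count => k /=.
by rewrite add1n exprSr dvdp_mul2r.
Qed.

(** Removing one irreducible factor [Q] lowers only the multiplicity of [Q], by one, and the degree
    by that of [Q]; induction on the degree replaces an explicit factorization. *)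
Lemma sum_irreducible_degree N n f : f \in ms n -> (n <= N)%N ->
  (\sum_(1 <= d < N.+1) \sum_(P <- ms d | irreducibleb P) d * mult_upto N P f = n)%N.
Proof.
elim/ltn_ind: n f => -[|n] IH f fn nN.
  rewrite big_nat big1 // => d /andP[d0 _]; rewrite big_seq_cond big1 // => P /andP[Pd _].
  rewrite /mult_upto (eq_in_count (a2 := pred0)) ?count_pred0 ?muln0 //.
  move=> k; rewrite mem_iota => /andP[k0 _] /=; apply/negP.
  move/(monic_seq_dvdp_leq (monic_seq_exp _ Pd) fn).
  by rewrite leqn0 muln_eq0 !gtn_eqF.
have [e [Q [e0 Qe iQ /dvdpP[g fE]]]] := ex_irreducible_dvdp fn isT.
have en : (e <= n.+1)%N by apply: (monic_seq_dvdp_leq Qe fn); rewrite fE dvdp_mull.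
have gn : g \in ms (n.+1 - e) by apply: monic_seq_divl Qe _; rewrite -fE.
have ln : (n.+1 - e < n.+1)%N by rewrite ltn_subrL e0.
rewrite -[RHS](subnK en) -{1}(IH _ ln g gn (leq_trans (leq_subr _ _) nN)).
transitivity (\sum_(1 <= d < N.+1) (\sum_(P <- ms d | irreducibleb P) d * mult_upto N P g +
   \sum_(P <- ms d | irreducibleb P) d * (P == Q)))%N.
  rewrite big_nat [RHS]big_nat; apply: eq_bigr => d /andP[d0 _].
  rewrite -big_split /= big_seq_cond [RHS]big_seq_cond; apply: eq_bigr => P /andP[Pd iP].
  by rewrite fE (mult_upto_mul Pd Qe gn) ?mulnDr // (leq_trans ln).
rewrite big_split /=; congr addn.
rewrite (bigD1_seq e) ?iota_uniq //=; last by rewrite mem_index_iota e0 ltnS (leq_trans en).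
rewrite [X in (X + _)%N]big_mkcond (bigD1_seq Q) ?monic_seq_uniq //= iQ eqxx muln1.
rewrite [X in (_ + X + _)%N]big1 => [|P /negbTE->]; last by rewrite muln0 if_same.
rewrite addn0 big1 ?addn0 // => d de; rewrite big_seq_cond big1 // => P /andP[Pd _].
case: eqP => [PQ|_]; last by rewrite muln0.
move: Pd Qe; rewrite PQ !mem_monic_seq => /andP[_ /eqP ->] /andP[_ /eqP[ed]].
by rewrite ed eqxx in de.
Qed.

End Factorization.

(** The ranges of [k] and [d] no longer depend on [i], which allows exchanging them with a sum over
    [i]. *)
Lemma sum_divisors_factor (V : nmodType) n i (G : nat -> nat -> V) : (0 < i <= n)%N ->
  \sum_(k <- divisors i) G k (i %/ k)%N =
  \sum_(1 <= d < n.+1) \sum_(1 <= k < n.+1 | (k * d == i)%N) G k d.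
Proof.
move=> /andP[i0 iN]; rewrite (exchange_big_dep predT) //=.
transitivity (\sum_(1 <= k < n.+1 | (k %| i)%N) G k (i %/ k)%N).
  rewrite -[RHS]big_filter; apply/perm_big/uniq_perm.
  - exact: divisors_uniq.
  - by rewrite filter_uniq ?iota_uniq.
  move=> k; rewrite mem_filter mem_index_iota -dvdn_divisors //.
  case ki: (k %| i)%N => //=; rewrite (dvdn_gt0 i0) // ltnS.
  by rewrite (leq_trans (dvdn_leq i0 ki)).
rewrite big_mkcond big_nat [RHS]big_nat; apply: eq_bigr => k /andP[k0 _].
case: ifP => ki; last first.
  by rewrite big1 // => d /eqP kd; rewrite -kd dvdn_mulr in ki.
rewrite (eq_bigl (fun d => d == (i %/ k)%N)) => [|d].
  by rewrite big_nat1_eq divn_gt0 // (dvdn_leq i0 ki) ltnS (leq_trans (leq_div _ _)).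
by rewrite eqn_div // mulnC.
Qed.

(** * The logarithmic derivative of an Euler product *)

Section EulerProduct.
Variables (F : finFieldType) (K : fieldType) (h : {poly F} -> K).
Hypothesis K0 : [pchar K] =i pred0.
Hypothesis h1 : h 1 = 1.
Hypothesis hM : {in [qualify a f | f \is monic] &, {morph h : f g / f * g}}.
Local Notation ms := (monic_seq F).

Let H : nat -> K^o := fun d => \sum_(f <- ms d) h f.

Lemma mult_monicX P k : P \is monic -> h (P ^+ k) = h P ^+ k.
Proof.
move=> mP; elim: k => [|k IH]; first by rewrite !expr0.
by rewrite !exprS hM ?IH // rpredX.
Qed.

Lemma sum_monic_dvdp a n P : P \in ms a -> (a <= n)%N ->
  h P * H (n - a) = \sum_(f <- ms n | P %| f) h f.
Proof.
move=> Pa an; have mP : P \is monic by move: Pa; rewrite mem_monic_seq => /andP[].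
rewrite /H mulr_sumr -[RHS]big_filter.
rewrite [RHS](perm_big [seq P * g | g <- ms (n - a)]) /=.
  rewrite big_map; apply: eq_big_seq => g; rewrite mem_monic_seq => /andP[mg _].
  by rewrite hM.
apply: uniq_perm.
- by rewrite filter_uniq ?monic_seq_uniq.
- by rewrite map_inj_uniq ?monic_seq_uniq //; apply/mulfI/monic_neq0.
move=> f; rewrite mem_filter; apply/andP/mapP => [[/dvdpP[g ->] fn]|[g gn ->]].
  by exists g; [apply: monic_seq_divl Pa fn|rewrite mulrC].
by rewrite dvdp_mulIl -{1}(subnKC an) monic_seq_mul.
Qed.

(** By [logderiv_unique] it suffices to multiply the claimed series by [H]. The term of [P] and [k]
    then spreads over the [f] divisible by [P ^+ k], and for fixed [f] the degrees of [P] add up to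
    [n]. *)
Lemma logderiv_euler n : (0 < n)%N -> logderiv H n =
  \sum_(k <- divisors n) \sum_(P <- ms (n %/ k) | irreducibleb P)
    (n %/ k)%:R * h P ^+ k.
Proof.
move=> n0; pose Lam i : K := \sum_(k <- divisors i)
  \sum_(P <- ms (i %/ k) | irreducibleb P) (i %/ k)%:R * h P ^+ k.
rewrite (@logderiv_unique _ K0 _ (fun i => if i == 0%N then 0 else Lam i)).
  by rewrite gtn_eqF.
  by rewrite /H (perm_big _ (monic_seq0 F)) big_seq1.
move=> {n0}n.
pose G k d : K := \sum_(P <- ms d | irreducibleb P) d%:R * h P ^+ k.
transitivity (\sum_(i < n.+1) \sum_(1 <= d < n.+1) \sum_(1 <= k < n.+1 | (k * d == i)%N)
    G k d * H (n - i)).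
  apply: eq_bigr => i _; case: (posnP i) => [->|i0].
    rewrite mul0r big_nat big1 // => d /andP[d0 _]; rewrite big_nat_cond big1 //.
    by move=> k /andP[/andP[k0 _]]; rewrite muln_eq0 !gtn_eqF.
  rewrite /Lam (sum_divisors_factor (n := n) (fun k d => G k d)); last by rewrite i0 -ltnS /=.
  by rewrite mulr_suml; apply: eq_bigr => d _; rewrite mulr_suml.
rewrite exchange_big /=.
transitivity (\sum_(1 <= d < n.+1) \sum_(1 <= k < n.+1) \sum_(P <- ms d | irreducibleb P)
    \sum_(f <- ms n | P ^+ k %| f) d%:R * h f).
  rewrite big_nat [RHS]big_nat; apply: eq_bigr => d /andP[d0 _].
  rewrite (exchange_big_dep predT) //= big_nat [RHS]big_nat.
  (* When [k * d > n] both sides vanish: there is no index [i], and no multiple of [P ^+ k] in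
     degree [n]. *)
  apply: eq_bigr => k /andP[k0 _]; case: (leqP (k * d) n) => kdn; last first.
    rewrite big1 => [|i /eqP ki]; last by have := ltn_ord i; rewrite ltnS -ki leqNgt kdn.
    rewrite big_seq_cond big1 // => P /andP[Pd _]; rewrite big_seq_cond big1 // => f /andP[fn].
    by move/(monic_seq_dvdp_leq (monic_seq_exp k Pd) fn); rewrite leqNgt kdn.
  rewrite (big_pred1 (Ordinal (kdn : (k * d < n.+1)%N))) => [/=|i]; last by rewrite eq_sym.
  rewrite /G mulr_suml big_seq_cond [RHS]big_seq_cond; apply: eq_bigr => P /andP[Pd _].
  rewrite -mulr_sumr -mulrA; congr (_ * _).
  rewrite -(sum_monic_dvdp (monic_seq_exp k Pd) kdn) mult_monicX //.
  by move: Pd; rewrite mem_monic_seq => /andP[].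
transitivity (\sum_(f <- ms n) h f *
   (\sum_(1 <= d < n.+1) \sum_(P <- ms d | irreducibleb P) d * mult_upto n P f)%N%:R).
  under [RHS]eq_bigr do rewrite natr_sum mulr_sumr.
  rewrite [RHS]exchange_big; apply: eq_bigr => d _.
  under [RHS]eq_bigr do rewrite natr_sum mulr_sumr.
  rewrite [RHS]exchange_big [LHS]exchange_big; apply: eq_bigr => P _ /=.
  rewrite (exchange_big_dep predT) //=; apply: eq_bigr => f _.
  rewrite natrM mulrCA /mult_upto -sum1_count natr_sum !mulr_sumr /index_iota subn1.
  by apply: eq_bigr => k _; rewrite mulr1.
rewrite mulrC /H mulr_suml; apply: eq_big_seq => f fn.
by rewrite (sum_irreducible_degree fn).
Qed.

End EulerProduct.

(** * Characters *)

Section RootsOfUnity.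
Import Order.TTheory Num.Theory.
Variable R : realType.

Lemma omegaX n k : omega R n ^+ k =
  (cos (2 * pi / n%:R * k%:R) +i* sin (2 * pi / n%:R * k%:R))%C.
Proof.
rewrite /omega; move: (2 * pi / n%:R) => y.
elim: k => [|k IH]; first by rewrite expr0 mulr0 cos0 sin0.
rewrite exprSr IH -[k.+1%:R]natr1 mulrDr mulr1 cosD sinD.
by congr (_ +i* _)%C; rewrite addrC.
Qed.

Lemma omega_expr_order n : (0 < n)%N -> omega R n ^+ n = 1.
Proof.
move=> n0; rewrite omegaX divfK ?pnatr_eq0 -?lt0n //.
by rewrite mulr_natl cos2pi sin2pi.
Qed.

Lemma omega_neq0 n : (0 < n)%N -> omega R n != 0.
Proof.
move=> n0; apply: contra_eq_neq (omega_expr_order n0) => ->.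
by rewrite expr0n gtn_eqF // eq_sym oner_eq0.
Qed.

Lemma omega_expr_mod n k : (0 < n)%N -> omega R n ^+ (k %% n) = omega R n ^+ k.
Proof. by move=> n0; rewrite expr_mod // omega_expr_order. Qed.

(** With [y = pi k / n] strictly between 0 and [pi], the real part is
    [cos (2 y) = 1 - 2 sin(y)^2 < 1]. *)
Lemma omega_expr_neq1 n k : (0 < k < n)%N -> omega R n ^+ k != 1.
Proof.
move=> /andP[k0 kn]; have n0 : (0 < n)%N := leq_ltn_trans (leq0n _) kn.
rewrite omegaX; apply/negP; rewrite eq_complex => /andP[/eqP + _] /=.
move: (@sin_gt0_pi R) (pi_gt0 R); move: (pi : R) => p sin_p p0.
have -> : 2 * p / n%:R * k%:R = (p / n%:R * k%:R) *+ 2 by rewrite -[RHS]mulr_natl !mulrA.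
have {sin_p} : 0 < sin (p / n%:R * k%:R).
  apply: sin_p; rewrite !mulr_gt0 ?invr_gt0 ?ltr0n //=.
  by rewrite -mulrA gtr_pMr // mulrC ltr_pdivrMr ?ltr0n // mul1r ltr_nat.
move/(exprn_gt0 2); rewrite cos_mulr2n cos2sin2.
by move: (sin _ ^+ 2) => s s0 /= s1; lra.
Qed.

End RootsOfUnity.

(** * Characters of the class group and their orthogonality *)

Section Characters.
Import Order.TTheory Num.Theory.
Variables (R : realType) (F : finFieldType) (ell t m : nat).
Variable xi : 'I_m -> typeI F ell t.
Local Notation E := (typeI F ell t).
Local Notation C := R[i].
Local Notation r i := #[xi i]%g.
Implicit Types (u v : 'I_m -> nat) (j : idx xi) (x y : E).

Hypothesis xi_dprod : (\big[dprod/1]_(i < m) <[xi i]> = [set: E])%g.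

Lemma typeI_mulgC x y : (x * y)%g = (y * x)%g.
Proof. exact: typeI_mulC. Qed.

Lemma elt_ofD u v : (elt_of xi u * elt_of xi v)%g = elt_of xi (fun i => u i + v i)%N.
Proof.
rewrite /elt_of -prodgM_commute => [|i k _ _]; last exact: typeI_mulgC.
by apply: eq_bigr => i _; rewrite expgD.
Qed.

Lemma elt_ofX u k : (elt_of xi u ^+ k)%g = elt_of xi (fun i => k * u i)%N.
Proof.
elim: k => [|k IH]; last first.
  by rewrite expgS IH elt_ofD; apply: eq_bigr => i _; rewrite mulSn.
by rewrite expg0 /elt_of big1 // => i _; rewrite mul0n.
Qed.

Lemma elt_of_eqP u v :
  (elt_of xi u == elt_of xi v) = [forall i, u i == v i %[mod r i]].
Proof.
apply/eqP/forallP => [uv i|uv]; last first.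
  by apply: eq_bigr => i _; apply/eqP; rewrite eq_expg_mod_order.
have [c [_ _ cP]] := mem_bigdprod xi_dprod (in_setT (elt_of xi u)).
rewrite -eq_expg_mod_order (cP (fun i => xi i ^+ u i)%g) //; last first.
  by move=> k _; rewrite mem_cycle.
by rewrite -(cP (fun i => xi i ^+ v i)%g) // => k _; rewrite mem_cycle.
Qed.

Lemma ent_modP v : exists s : idx xi, forall i, ent s i = v i %[mod r i].
Proof.
(* An index stores the predecessor of its entry; adding [r i - 1] represents [v i - 1] modulo [r i]
   even when [v i = 0]. *)
have lt_r i : ((v i + (r i).-1) %% r i < r i)%N by rewrite ltn_pmod // order_gt0.
exists [ffun i => Ordinal (lt_r i)] => i; rewrite /ent ffunE /=.
rewrite -addn1 modnDml -addnA addn1 prednK ?order_gt0 //.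
by rewrite modnDr.
Qed.

Lemma elt_of_ent x : exists s : idx xi, elt_of xi (ent s) = x.
Proof.
have [c [cxi -> _]] := mem_bigdprod xi_dprod (in_setT x).
have ck i : {k | c i == xi i ^+ k}%g.
  by apply: sigW; have /cycleP[k ->] := cxi i isT; exists k.
have [s sE] := ent_modP (fun i => sval (ck i)); exists s.
apply: eq_bigr => i _; rewrite (eqP (svalP (ck i))); apply/eqP.
by rewrite eq_expg_mod_order; apply/eqP/sE.
Qed.

Lemma elt_of_ent_inj : injective (fun s : idx xi => elt_of xi (ent s)).
Proof.
move=> s s' /eqP; rewrite elt_of_eqP => /forallP ss'; apply/ffunP => i.
apply/val_inj => /=; have := ss' i.
by rewrite /ent -(addn1 (s i)) -(addn1 (s' i)) eqn_modDr !modn_small // => /eqP.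
Qed.

Lemma elt_of_ent_bij : bijective (fun s : idx xi => elt_of xi (ent s)).
Proof.
have ex x : exists s : idx xi, elt_of xi (ent s) == x.
  by have [s <-] := elt_of_ent x; exists s.
exists (fun x => xchoose (ex x)) => [s|x]; last exact/eqP/(xchooseP (ex x)).
exact/elt_of_ent_inj/eqP/(xchooseP (ex _)).
Qed.

Definition pairing u v : C := \prod_(i < m) omega R (r i) ^+ (u i * v i)%N.

Lemma pairing_mod u u' v : (forall i, u i = u' i %[mod r i]) -> pairing u v = pairing u' v.
Proof.
move=> uu'; apply: eq_bigr => i _; rewrite -(omega_expr_mod _ _ (order_gt0 _)).
by rewrite -modnMml uu' modnMml omega_expr_mod ?order_gt0.
Qed.

(** The pairing depends only on residues, so any exponent vector of an element computes [chi], not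
    just the one picked in [idx]. *)
Lemma chi_elt_of u j : chi R j (elt_of xi u) = pairing u (ent j).
Proof.
rewrite /chi; case: pickP => [s|]; last first.
  by have [s <-] := elt_of_ent (elt_of xi u) => /(_ s); rewrite eqxx.
rewrite elt_of_eqP => /forallP su; apply: pairing_mod => i; exact/eqP/su.
Qed.

Lemma chi_sym (j s : idx xi) : chi R j (elt_of xi (ent s)) = chi R s (elt_of xi (ent j)).
Proof. by rewrite !chi_elt_of; apply: eq_bigr => i _; rewrite mulnC. Qed.

Lemma chiM j x y : chi R j (x * y)%g = chi R j x * chi R j y.
Proof.
have [s <-] := elt_of_ent x; have [s' <-] := elt_of_ent y.
rewrite elt_ofD !chi_elt_of -big_split /=; apply: eq_bigr => i _.
by rewrite -exprD mulnDl.
Qed.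

Lemma chi_neq0 j x : chi R j x != 0.
Proof.
have [s <-] := elt_of_ent x; rewrite chi_elt_of; apply/prodf_neq0 => i _.
by rewrite expf_neq0 // omega_neq0 // order_gt0.
Qed.

Lemma chi1 j : chi R j 1%g = 1.
Proof. by apply: (mulfI (chi_neq0 j 1%g)); rewrite -chiM mulg1 mulr1. Qed.

Lemma chiV j x : chi R j x^-1%g = (chi R j x)^-1.
Proof.
apply: (mulfI (chi_neq0 j x)); rewrite -chiM mulgV chi1 mulfV //; exact: chi_neq0.
Qed.

Lemma chiX j x k : chi R j (x ^+ k)%g = chi R j x ^+ k.
Proof. by elim: k => [|k IH]; rewrite ?expg0 ?chi1 // expgS exprS chiM IH. Qed.

Lemma chi_top j x : is_top j -> chi R j x = 1.
Proof.
move/forallP => jt; have [s <-] := elt_of_ent x; rewrite chi_elt_of.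
rewrite /pairing big1 // => i _.
by rewrite (eqP (jt i)) mulnC exprM omega_expr_order ?order_gt0 ?expr1n.
Qed.

(** If the entry of [j] at [i] is not the order of [xi i], then [chi] differs from 1 at [xi i];
    translation by [xi i] multiplies the sum by that value, so the sum is 0. *)
Lemma sum_chi j : \sum_x chi R j x = if is_top j then #|E|%:R else 0.
Proof.
case: ifPn => [jt|/forallPn[i ji]].
  under eq_bigr do rewrite chi_top //.
  by rewrite sumr_const.
have chii : chi R j (xi i) != 1.
  (* Entries of [idx] are never 0, so the unit vector has to be a bare function. *)
  have -> : xi i = elt_of xi (fun k => (k == i) : nat).
    rewrite /elt_of (eq_bigr (fun k => if k == i then xi i else 1%g)).
      by rewrite -big_mkcond big_pred1_eq.
    by move=> k _; case: eqP => [->|_]; rewrite ?expg1 ?expg0.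
  rewrite chi_elt_of /pairing (bigD1 i) //= eqxx mul1n big1 ?mulr1; last first.
    by move=> k /negbTE->; rewrite mul0n expr0.
  by rewrite omega_expr_neq1 //= ltn_neqAle ji /ent ltn_ord.
apply/eqP; have : (chi R j (xi i) - 1) * \sum_x chi R j x == 0.
  rewrite mulrBl mul1r subr_eq0 mulr_sumr [eqbRHS](reindex_inj (mulgI (xi i))).
  by apply/eqP/eq_bigr => x _; rewrite chiM.
by rewrite mulf_eq0 subr_eq0 (negbTE chii).
Qed.

(* By [chi_sym] a sum over characters is a sum over group elements. *)
Lemma sum_chi_idx x : \sum_(j : idx xi) chi R j x = if x == 1%g then #|E|%:R else 0.
Proof.
have [s <-] := elt_of_ent x; under eq_bigr do rewrite chi_sym.
rewrite -(reindex _ (onW_bij _ elt_of_ent_bij) (P := predT) (F := chi R s)) /= sum_chi.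
congr (if _ then _ else _); rewrite (_ : 1%g = elt_of xi (fun=> 0%N)); last first.
  by rewrite /elt_of big1 // => i _; rewrite expg0.
rewrite elt_of_eqP; apply: eq_forallb => i; rewrite mod0n /ent.
(* Entries run from 1 to the order, so the order itself is the only one congruent to 0. *)
have := ltn_ord (s i); rewrite leq_eqVlt => /predU1P[->|lt]; first by rewrite modnn !eqxx.
by rewrite modn_small // (ltn_eqF lt).
Qed.

(** Summing over characters first, orthogonality kills every [y] other than [x]. *)
Lemma fourier_inversion (a : E -> C) x :
  #|E|%:R * a x = \sum_(j : idx xi) (chi R j x)^-1 * \sum_y a y * chi R j y.
Proof.
under eq_bigr do rewrite mulr_sumr.
rewrite exchange_big (bigD1 x) //= [X in _ + X]big1 => [|y yx].
  rewrite addr0 -[in LHS](_ : \sum_(j : idx xi) chi R j 1%g = #|E|%:R); last first.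
    by rewrite sum_chi_idx eqxx.
  rewrite mulr_suml; apply: eq_bigr => j _.
  by rewrite chi1 mul1r mulrCA mulVf ?mulr1 // chi_neq0.
have : \sum_(j : idx xi) chi R j (x^-1 * y)%g = 0.
  by rewrite sum_chi_idx -eq_mulVg1 eq_sym (negbTE yx).
move=> s0; transitivity (a y * \sum_(j : idx xi) chi R j (x^-1 * y)%g).
  by rewrite mulr_sumr; apply: eq_bigr => j _; rewrite chiM chiV mulrCA.
by rewrite s0 mulr0.
Qed.

Lemma fourier_inj (a b : E -> C) :
  (forall j, \sum_y a y * chi R j y = \sum_y b y * chi R j y) -> a =1 b.
Proof.
move=> ab x; have E0 : #|E|%:R != 0 :> C by rewrite pnatr_eq0 -lt0n (cardD1 x).
apply: (mulfI E0); rewrite !fourier_inversion.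
by apply: eq_bigr => j _; rewrite ab.
Qed.

End Characters.

(** * The coefficients [N_n] *)

Section GroupAlgebraEvaluation.
Variables (K : fieldType) (gT : finGroupType) (psi : gT -> K).
Hypothesis psi1 : psi 1%g = 1.
Hypothesis psiM : {morph psi : x y / (x * y)%g >-> x * y}.
Implicit Types a b : galg K gT.

(** The linear extension of the character [psi], a ring morphism on the group algebra. *)
Definition geval a : K := \sum_x gcoef a x * psi x.

Lemma geval_gbase x : geval (gbase K x) = psi x.
Proof.
rewrite /geval (bigD1 x) //= big1 => [|y /negbTE yx]; rewrite /gcoef ffunE ?yx ?mul0r //.
by rewrite eqxx mul1r addr0.
Qed.

Lemma gevalD a b : geval (a + b) = geval a + geval b.
Proof. by rewrite -big_split; apply: eq_bigr => x _; rewrite /gcoef ffunE mulrDl. Qed.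

Lemma gevalZ k a : geval (k *: a) = k * geval a.
Proof. by rewrite mulr_sumr; apply: eq_bigr => x _; rewrite /gcoef ffunE mulrA. Qed.

Lemma geval0 : geval 0 = 0.
Proof. by rewrite -[0 in LHS](scale0r (0 : galg K gT)) gevalZ mul0r. Qed.

Lemma geval_sum I (s : seq I) (P : pred I) (G : I -> galg K gT) :
  geval (\sum_(i <- s | P i) G i) = \sum_(i <- s | P i) geval (G i).
Proof. exact: (big_morph geval gevalD geval0). Qed.

Lemma geval1 : geval 1 = 1.
Proof. by rewrite -psi1 -geval_gbase. Qed.

Lemma gevalM a b : geval (a * b) = geval a * geval b.
Proof.
rewrite /geval mulr_suml.
transitivity (\sum_x \sum_y gcoef a y * gcoef b (y^-1 * x)%g * psi x).
  by apply: eq_bigr => x _; rewrite -mulr_suml; congr (_ * _); exact: ffunE.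
rewrite exchange_big; apply: eq_bigr => y _; rewrite mulr_sumr (reindex_inj (mulgI y)).
by apply: eq_bigr => x _; rewrite mulKg psiM -!mulrA; congr (_ * _); rewrite mulrCA.
Qed.

(** Each coefficient of [ps_ln] is a finite polynomial expression in the coefficients of the series,
    hence preserved by the morphism. *)
Lemma geval_ps_ln (A : nat -> galg K gT) n :
  geval (ps_ln A n) = ps_ln (fun i => geval (A i) : K^o) n.
Proof.
have ps1 i : geval (ps_one _ i) = ps_one K^o i.
  by rewrite /ps_one; case: eqP; rewrite ?geval1 ?geval0.
have expE k i : geval (ps_exp (fun i => A i - ps_one _ i) k i) =
    ps_exp (fun i => (geval (A i) : K^o) - ps_one _ i) k i.
  elim: k i => [|k IH] i; first exact: ps1.
  rewrite geval_sum; apply: eq_bigr => l _; rewrite gevalM IH; congr (_ * _).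
  by rewrite -scaleN1r gevalD gevalZ mulN1r ps1.
by rewrite geval_sum; apply: eq_bigr => k _; rewrite gevalZ expE.
Qed.

End GroupAlgebraEvaluation.

(** * Fourier inversion for [N_n] and Moebius inversion for [I_d] *)

Section Coefficients.
Variables (R : realType) (F : finFieldType) (ell t m : nat).
Hypotheses (ell_gt0 : (0 < ell)%N) (t_gt0 : (0 < t)%N).
Variable xi : 'I_m -> typeI F ell t.
Local Notation E := (typeI F ell t).
Local Notation C := R[i].
Local Notation r i := #[xi i]%g.
Local Notation ms := (monic_seq F).
Local Notation cls := (typeI_class ell t).
Local Notation q := (#|F|%:R : C).
Local Notation tau := (ell + t - 1)%N.
Hypothesis xi_dprod : (\big[dprod/1]_(i < m) <[xi i]> = [set: E])%g.
Implicit Types (j s : idx xi) (x y e : E).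

Lemma pchar_complex : [pchar C] =i pred0.
Proof. exact: Num.Theory.pchar_num. Qed.

Definition cls_value (psi : E -> C) (f : {poly F}) : C := oapp psi 0 (cls f).

Definition chiF j (d : nat) : C^o := \sum_(f <- ms d) cls_value (chi R j) f.

Lemma typeI_class1 : cls (1 : {poly F}) = Some 1%g.
Proof. exact: (typeI_class_pi ell t (typeI_poly1 F)). Qed.

(** A product vanishes at 0 exactly when a factor does, so the default value 0 is compatible with
    multiplication. *)
Lemma cls_value_mul (psi : E -> C) : {morph psi : x y / (x * y)%g >-> x * y} ->
  {in [qualify a f | f \is monic] &, {morph cls_value psi : f g / f * g}}.
Proof.
move=> psiM f g mf mg; rewrite /cls_value; case cfg: (cls (f * g)) => [e|] /=.
  have : typeI_dom (f * g) by rewrite -(typeI_class_dom ell t) cfg.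
  rewrite /typeI_dom hornerM mulf_eq0 negb_or => /and3P[_ f0 g0].
  have df : typeI_dom f by apply/andP.
  have dg : typeI_dom g by apply/andP.
  move: cfg; rewrite (typeI_classM ell t (TypeIPoly df) (TypeIPoly dg)) => -[<-].
  rewrite psiM (typeI_class_pi ell t (TypeIPoly df)).
  by rewrite (typeI_class_pi ell t (TypeIPoly dg)).
have : ~~ typeI_dom (f * g) by rewrite -(typeI_class_dom ell t) cfg.
rewrite /typeI_dom hornerM mulf_eq0 negb_and monicMl // mg negbK /=.
have cls0 u : u.[0] == 0 -> cls u = None.
  move=> u0; have := typeI_class_dom ell t u; rewrite /typeI_dom u0 andbF.
  by case: (cls u).
by case/orP=> /cls0 ->; rewrite ?mul0r ?mulr0.
Qed.

Lemma geval_genF j d : geval (chi R j) (genF R F ell t d) = chiF j d.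
Proof.
transitivity (\sum_(f in monics F d | predT (f : {poly F})) cls_value (chi R j) f).
  rewrite geval_sum; apply: eq_big => [f|f _]; first by rewrite andbT.
  rewrite /angle /cls_value; case: (cls f) => [e|] /=; last exact: geval0.
  exact: geval_gbase.
by rewrite big_monics.
Qed.

Lemma chiF0 j : chiF j 0%N = 1.
Proof.
by rewrite /chiF (perm_big _ (monic_seq0 F)) big_seq1 /cls_value typeI_class1 /= chi1.
Qed.

Lemma chiF_top j d : is_top j -> (0 < d)%N -> chiF j d = q ^+ d - q ^+ d.-1.
Proof.
case: d => // d jt _; rewrite -!natrX -natrB; last first.
  by rewrite leq_pexp2l // ltnW // card_finNzRing_gt1.
rewrite -count_monic_coef0 -sum1_count natr_sum [RHS]big_mkcond.
apply: eq_big_seq => f; rewrite mem_monic_seq => /andP[mf _].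
have := typeI_class_dom ell t f; rewrite /typeI_dom mf /= /cls_value.
by case: (cls f) => [e|] /= <- //; rewrite chi_top.
Qed.

Lemma count_classes_deg d e : (d <= tau)%N ->
  count (fun f => cls f == Some e) (ms d) = (e \in classes_deg F ell t d).
Proof.
move=> dt; have lt_d : (d < ell + t)%N.
  by rewrite (leq_ltn_trans dt) // subn1 prednK // addn_gt0 ell_gt0.
rewrite inE; case: (boolP [exists f in _, _]) => [/exists_inP[f fd /eqP fe]|/exists_inPn nex].
  have fms : (f : {poly F}) \in ms d by rewrite mem_monic_seq; move: fd; rewrite inE.
  rewrite (eq_in_count (a2 := pred1 (f : {poly F}))) ?count_uniq_mem ?monic_seq_uniq ?fms //.
  move=> g gms /=; apply/eqP/eqP => [ge|->] //.
  apply: (typeI_class_inj lt_d gms fms); last by rewrite ge.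
  by rewrite -(typeI_class_dom ell t) ge.
rewrite (eq_in_count (a2 := pred0)) ?count_pred0 // => g.
by case/mapP => f; rewrite mem_enum => /nex /negbTE fe ->.
Qed.

Lemma coef_Ppoly j d : (Ppoly R j)`_d =
  if d == 0%N then 1 else if (d <= tau)%N then ccoef R d j else 0.
Proof.
rewrite coefD coef1 coef_sum.
rewrite (eq_bigr (fun k => if k == d then ccoef R k j else 0)); last first.
  by move=> k _; rewrite coefZ coefXn eq_sym mulr_natr mulrb.
rewrite -big_mkcond big_nat1_eq ltnS; case: d => [|d] /=; first by rewrite addr0.
by rewrite add0r.
Qed.

Lemma chiF_Ppoly j d : ~~ is_top j -> chiF j d = (Ppoly R j)`_d.
Proof.
move=> jt; rewrite coef_Ppoly; case: posnP => [->|d0]; first exact: chiF0.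
rewrite /chiF sum_typeI_class; case: leqP => dt.
  rewrite [RHS]big_mkcond; apply: eq_bigr => e _.
  by rewrite count_classes_deg // mulrb.
(* Here [d > tau] means [d >= ell + t]; the common multiplicity factors out of a vanishing character
   sum. *)
rewrite (eq_bigr (fun e => chi R j e *+ #|F| ^ (d - (ell + t)))) => [|e _]; last first.
  by rewrite count_typeI_class //; move: dt; rewrite subn1 prednK // addn_gt0 ell_gt0.
by rewrite sumrMnl sum_chi // (negbTE jt) mul0rn.
Qed.

(** The coefficients [q^d - q^(d-1)] telescope against [1 - q z], leaving [1 - z]; additivity then
    gives [-1] minus [- q^n]. *)
Lemma logderiv_chiF_top j n : is_top j -> (0 < n)%N -> logderiv (chiF j) n = q ^+ n - 1.
Proof.
move=> jt n0; have K0 := pchar_complex.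
have cE (a : C) : (fun i => (1 - a *: 'X : {poly C})`_i : C^o) 0%N = 1.
  by rewrite coefB coef1 coefZ coefX mulr0 subr0.
have E1 : ps_mul (fun i => (1 - q *: 'X : {poly C})`_i : C^o) (chiF j) =1
     fun i => (1 - 1 *: 'X : {poly C})`_i.
  have cq (a : C) i : (1 - a *: 'X : {poly C})`_i = (i == 0)%:R - a * (i == 1)%:R.
    by rewrite coefB coef1 coefZ coefX.
  case=> [|k]; first by rewrite /ps_mul big_ord1 chiF0 !cq /= !mulr0 !subr0 mulr1.
  rewrite /ps_mul big_ord_recl big_ord_recl big1 ?addr0 => [|i _]; last first.
    by rewrite cq /= !mulr0 subr0 mul0r.
  rewrite !cq /bump /= subn0 subSS subn0 (chiF_top jt) //=.
  rewrite !mulr0 !mulr1 subr0 !sub0r mul1r mul1r.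
  case: k => [|k]; first by rewrite chiF0 expr0 expr1 mulr1 addrAC subrr sub0r.
  by rewrite (chiF_top jt) //= mulNr mulrBr -!exprS subrr ?mulr0 oppr0.
have := logderivM K0 n (cE q) (chiF0 j); rewrite (eq_logderiv E1).
rewrite !logderiv_linear // expr1n => /eqP; rewrite addrC -subr_eq => /eqP <-.
by rewrite opprK addrC.
Qed.

Lemma card_typeI_complex : #|E|%:R = (q - 1) * q ^+ tau.
Proof.
by rewrite (card_typeI F ell t_gt0) natrM natrX natrB // ltnW ?card_finNzRing_gt1.
Qed.

Lemma sum_Ncoef_chi n j : \sum_e Ncoef R n e * chi R j e = logderiv (chiF j) n.
Proof.
rewrite /Ncoef /logderiv; under eq_bigr do rewrite -mulrA.
rewrite -mulr_sumr; congr (_ * _).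
rewrite -(eq_ps_ln (geval_genF j)) -geval_ps_ln //; [exact: chi1|exact: chiM].
Qed.

Lemma chi_ent_inv j s :
  (chi R j (elt_of xi (ent s)))^-1 = \prod_(i < m) omega R (r i) ^- (ent j i * ent s i).
Proof.
by rewrite chi_elt_of // -prodfV; apply: eq_bigr => i _; rewrite mulnC.
Qed.

Lemma ex_top : exists j0 : idx xi, is_top (xi := xi) =1 pred1 j0.
Proof.
have lt_r i : ((r i).-1 < r i)%N by rewrite prednK // order_gt0.
exists [ffun i => Ordinal (lt_r i)] => j; apply/forallP/eqP => [jt|-> i].
  apply/ffunP => i; rewrite ffunE; apply: val_inj => /=.
  exact: (congr1 predn (eqP (jt i))).
by rewrite /ent ffunE /= prednK // order_gt0.
Qed.

Lemma Ncoef_logderiv n s : (0 < n)%N ->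
  Ncoef R n (elt_of xi (ent s)) =
    (q - 1)^-1 * q ^- tau * (q ^+ n - 1) +
    (q - 1)^-1 * q ^- tau *
      \sum_(j : idx xi | ~~ is_top j)
        (\prod_(i < m) omega R (r i) ^- (ent j i * ent s i)) *
          logderiv (fun k => (Ppoly R j)`_k : C^o) n.
Proof.
move=> n0; have E0 : #|E|%:R != 0 :> C by rewrite Num.Theory.pnatr_eq0 -lt0n (cardD1 1%g).
(* The prefactor is the inverse of the group order, so the claim is Fourier inversion after clearing
   it. *)
rewrite -mulrDr -invfM -card_typeI_complex; apply: (mulfI E0); rewrite mulVKf //.
rewrite (fourier_inversion (R := R) xi_dprod (Ncoef R n)) (bigID (@is_top _ _ _ _ xi)) /=.
congr (_ + _).
  have [j0 j0P] := ex_top; rewrite (eq_bigl _ _ j0P) big_pred1_eq.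
  have jt : is_top j0 by rewrite j0P /= eqxx.
  by rewrite sum_Ncoef_chi (chi_top R xi_dprod _ jt) invr1 mul1r logderiv_chiF_top.
apply: eq_bigr => j jt.
by rewrite sum_Ncoef_chi chi_ent_inv (eq_logderiv (fun d => chiF_Ppoly d jt)).
Qed.

Lemma logderiv_Ppoly j n : (0 < n)%N ->
  logderiv (fun k => (Ppoly R j)`_k : C^o) n =
    - \sum_(rho <- root_mset (Ppoly R j)) rho ^- n.
Proof.
move=> n0; apply: (logderiv_roots pchar_complex n0); first by rewrite coef_Ppoly.
exact: svalP (closed_field_poly_normal _).
Qed.

Lemma Icount_count d e :
  Icount d e = count (fun f => irreducibleb f && (cls f == Some e)) (ms d).
Proof.
rewrite /Icount -sum1_card -sum1_count -big_monics.
by apply: eq_bigl => f; rewrite !inE.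
Qed.

Lemma sum_irreducible_cls (psi : E -> C) d :
  \sum_(P <- ms d | irreducibleb P) cls_value psi P = \sum_e (Icount d e)%:R * psi e.
Proof.
rewrite -big_filter sum_typeI_class; apply: eq_bigr => e _.
rewrite Icount_count count_filter mulr_natl; congr (_ *+ _).
by apply: eq_count => f; rewrite /= andbC.
Qed.

(** Both sides are compared under every character: the left becomes the logarithmic derivative of
    the Euler product, where [chiX] lets the irreducibles be grouped by class. *)
Lemma Ncoef_Icount n e : (0 < n)%N ->
  Ncoef R n e = \sum_(k <- divisors n) (n %/ k)%:R *
    \sum_x (Icount (n %/ k) x)%:R * ((x ^+ k)%g == e)%:R.
Proof.
move=> n0; apply: (fourier_inj (R := R) xi_dprod
    (b := fun e => \sum_(k <- divisors n) (n %/ k)%:R *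
      \sum_x (Icount (n %/ k) x)%:R * ((x ^+ k)%g == e)%:R)) => j.
rewrite sum_Ncoef_chi.
rewrite (logderiv_euler pchar_complex _ (cls_value_mul (chiM R xi_dprod j))) //; last first.
  by rewrite /cls_value typeI_class1 /= chi1.
under [RHS]eq_bigr do rewrite mulr_suml.
rewrite [RHS]exchange_big; apply: eq_big_seq => k; rewrite -dvdn_divisors // => kn.
have k0 := dvdn_gt0 n0 kn; rewrite -mulr_sumr.
under [RHS]eq_bigr do rewrite -mulrA.
rewrite -mulr_sumr; congr (_ * _).
transitivity (\sum_(P <- ms (n %/ k) | irreducibleb P)
    cls_value (fun x => chi R j (x ^+ k)%g) P).
  apply: eq_bigr => P _; rewrite /cls_value; case: (cls P) => [x|] /=; first by rewrite chiX.
  (* Since [k > 0], the value 0 of a polynomial without a class survives the power. *)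
  by rewrite expr0n gtn_eqF.
rewrite sum_irreducible_cls.
under [RHS]eq_bigr do rewrite mulr_suml.
rewrite [RHS]exchange_big; apply: eq_bigr => x _ /=.
rewrite (bigD1 (x ^+ k)%g) //= eqxx mulr1 big1 ?addr0 // => y.
by rewrite eq_sym => /negbTE->; rewrite mulr0 mul0r.
Qed.

(** After inserting [Ncoef_Icount], the terms other than [mobius k] involve [k] and [l] only through
    [a = k l], because [(x^l)^k = x^a]; [sum_mobius] leaves [a = 1]. *)
Lemma Icount_mobius d e : (0 < d)%N ->
  (Icount d e)%:R = d%:R^-1 * \sum_(k <- divisors d) (mobius k)%:~R *
    \sum_x Ncoef R (d %/ k) x * ((x ^+ k)%g == e)%:R.
Proof.
move=> d0; pose B a : C := (d %/ a)%:R * \sum_x (Icount (d %/ a) x)%:R * ((x ^+ a)%g == e)%:R.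
transitivity (d%:R^-1 * \sum_(a <- divisors d) \sum_(k <- divisors a) (mobius k)%:~R * B a).
  have -> : \sum_(a <- divisors d) \sum_(k <- divisors a) (mobius k)%:~R * B a =
            \sum_(a <- divisors d) if a == 1%N then B a else 0.
    apply: eq_big_seq => a; rewrite -dvdn_divisors // => ad.
    rewrite -mulr_suml -rmorph_sum /= sum_mobius ?(dvdn_gt0 d0) //.
    by case: eqP; rewrite ?mul1r ?mul0r.
  rewrite (bigD1_seq 1%N) ?divisors_uniq ?divisor1 //= big1 => [|a /negbTE->] //.
  rewrite addr0 /B divn1 mulKf; last by rewrite Num.Theory.pnatr_eq0 -lt0n.
  rewrite (eq_bigr (fun x => if x == e then (Icount d x)%:R else 0)); last first.
    by move=> x _; rewrite expg1 mulr_natr mulrb.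
  by rewrite -big_mkcond big_pred1_eq.
congr (_ * _); rewrite -(sum_divisors_mul d0 (fun k a => (mobius k)%:~R * B a)).
apply: eq_big_seq => k; rewrite -dvdn_divisors // => kd; rewrite -mulr_sumr; congr (_ * _).
have dk0 : (0 < d %/ k)%N by rewrite divn_gt0 ?(dvdn_gt0 d0) // dvdn_leq.
under [RHS]eq_bigr do rewrite (Ncoef_Icount _ dk0) mulr_suml.
rewrite [RHS]exchange_big; apply: eq_bigr => l _; rewrite /B divnMA.
under [RHS]eq_bigr do rewrite -mulrA mulr_suml.
rewrite -mulr_sumr; congr (_ * _); rewrite [RHS]exchange_big; apply: eq_bigr => x _ /=.
rewrite (bigD1 (x ^+ l)%g) //= eqxx mulr1 big1 ?addr0 => [|y].
  by rewrite -expgM mulnC.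
by rewrite eq_sym => /negbTE->; rewrite mulr0 mul0r.
Qed.

End Coefficients.

Theorem theorem3 (R : realType) (F : finFieldType) (ell t : nat)
    (ell_gt0 : (0 < ell)%N) (t_gt0 : (0 < t)%N)
    (m : nat) (xi : 'I_m -> typeI F ell t)
    (xi_dprod : (\big[dprod/1]_(i < m) <[xi i]> = [set: typeI F ell t])%g) :
  let q : R[i] := #|F|%:R in
  let tau := (ell + t - 1)%N in
  (forall (v : 'I_m -> nat) (d : nat), (0 < d)%N ->
     (Icount d (elt_of xi v))%:R =
       d%:R^-1 * \sum_(k <- divisors d) (mobius k)%:~R *
         \sum_(s : idx xi) Ncoef R (d %/ k) (elt_of xi (ent s)) *
           [forall i : 'I_m, k * ent s i == v i %[mod #[xi i]%g]]%:R) /\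
  (forall (n : nat) (s : idx xi), (0 < n)%N ->
     Ncoef R n (elt_of xi (ent s)) =
       (q - 1)^-1 * q ^- tau * (q ^+ n - 1) +
       (q - 1)^-1 * q ^- tau *
         \sum_(j : idx xi | ~~ is_top j)
           (\prod_(i < m) omega R #[xi i]%g ^- (ent j i * ent s i)) *
             (n%:R * ps_ln (fun k => (Ppoly R j)`_k : R[i]^o) n)
     /\
     Ncoef R n (elt_of xi (ent s)) =
       (q - 1)^-1 * q ^- tau * (q ^+ n - 1) -
       (q - 1)^-1 * q ^- tau *
         \sum_(j : idx xi | ~~ is_top j)
           (\prod_(i < m) omega R #[xi i]%g ^- (ent j i * ent s i)) *
             \sum_(rho <- root_mset (Ppoly R j)) rho ^- n).
Proof.
move=> q tau; split=> [v d d0|n s n0].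
  rewrite (Icount_mobius R xi_dprod) //; congr (_ * _); apply: eq_bigr => k _; congr (_ * _).
  (* Classes are traded for exponent vectors, which turns [x ^+ k = elt_of xi v] into the
     congruences. *)
  rewrite (reindex (fun s : idx xi => elt_of xi (ent s))) /=; last first.
    exact: onW_bij (elt_of_ent_bij xi_dprod).
  by apply: eq_bigr => s _; rewrite elt_ofX elt_of_eqP.
have N1 := Ncoef_logderiv R ell_gt0 t_gt0 xi_dprod s n0; split=> //.
rewrite N1 -mulrN -sumrN; congr (_ + _ * _); apply: eq_bigr => j _.
by rewrite logderiv_Ppoly // mulrN.
Qed.
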